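(* Consider the Gaussian linear regression model $\mathbf{y}=X\boldsymbol{\beta}+\boldsymbol{\epsilon}$ with $X\in\mathbb{R}^{n\times p}$, $r=\mathrm{rank}(X)$, any $r$ columns of $X$ linearly independent, $\boldsymbol{\beta}\in\mathbb{R}^p$ and $\boldsymbol{\epsilon}\sim N(\mathbf{0},\sigma^2 I_n)$ with known $\sigma^2>0$. Let $\gamma>0$ and $c(\gamma)=8(\gamma+3/4)^2$. Let $\pi$ be a probability distribution on $\{0,1,\dots,r\}$ with $\pi(k)>0$ for all $k$, satisfying $$\pi(k)\le \binom{p}{k}e^{-c(\gamma)k},\quad k=0,\dots,r-1,\qquad \pi(r)\le e^{-c(\gamma)r},$$ and, in addition, $$\pi(0)\ge p^{-c},\qquad \pi(k)\ge p^{-ck},\quad k=1,\dots,r,$$ for some constant $c>0$. Let $\hat M$ be the resulting MAP model selector and $\hat{\boldsymbol{\beta}}_{\hat M}$ the corresponding least squares estimate. Then $$E\|X\hat{\boldsymbol{\beta}}_{\hat M}-X\boldsymbol{\beta}\|^2\le c_2(\gamma)\,\ln p\,\left(\inf_M E\|X\hat{\boldsymbol{\beta}}_M-X\boldsymbol{\beta}\|^2+\sigma^2\right)$$ for some $c_2(\gamma)\ge 1$ (a constant multiplier depending on $\gamma$).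
   Context: A model $M$ is a subset of the $p$ predictors (columns of $X$), with $|M|$ its size; only models with $|M|\le r$ are considered (the prior $\pi$ gives zero mass to sizes larger than $r$), and all minimizations and infima over $M$ are over these models. All models of size $r$ give the same estimate of the mean vector $X\boldsymbol{\beta}$ and are identified with a single saturated model. $D_M$ is the $p\times p$ diagonal matrix with $j$th diagonal entry equal to $1$ if the $j$th predictor belongs to $M$ and $0$ otherwise. The least squares estimate for $M$ is $\hat{\boldsymbol{\beta}}_M=(D_MX'XD_M)^{+}D_MX'\mathbf{y}$, where $^{+}$ denotes the generalized inverse; thus $X\hat{\boldsymbol{\beta}}_M$ is the orthogonal projection of $\mathbf{y}$ on the span of the columns of $X$ in $M$. The MAP model selector $\hat M$ for the prior $\pi$ and parameter $\gamma$ is a solution of $\|\mathbf{y}-X\hat{\boldsymbol{\beta}}_M\|^2+Pen(|M|)\to\min_M$, where $$Pen(k)=2\sigma^2(1+1/\gamma)\ln\left\{\binom{p}{k}\pi(k)^{-1}(1+\gamma)^{k/2}\right\},\quad k=0,\dots,r-1,$$ $$Pen(r)=2\sigma^2(1+1/\gamma)\ln\left\{\pi(r)^{-1}(1+\gamma)^{r/2}\right\}.$$ $\|\cdot\|$ is the Euclidean norm and $E$ is the expectation with respect to $\boldsymbol{\epsilon}$.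
   Formalization: The constant multiplier c_2 is allowed to depend on the constant c of the lower bounds on the prior as well as on γ; with dependence on γ alone, uniformly in c, the claim is false (X = I_2, π(k) = 2^{-ck} for k = 1, 2, c large). *)

(* Defs.v *)
From HB Require Import structures.
From mathcomp Require Import all_boot all_order all_algebra.
From mathcomp Require Import all_classical all_reals all_analysis.

Set Implicit Arguments.
Unset Strict Implicit.
Unset Printing Implicit Defensive.

Import Order.TTheory GRing.Theory Num.Theory.

Local Open Scope classical_set_scope.
Local Open Scope ring_scope.

Section MoorePenrose.
Variable R : realType.

(* The four Penrose equations, for real matrices. *)
Definition penrose m n (A : 'M[R]_(m, n)) (G : 'M[R]_(n, m)) : Prop :=
  [/\ A *m G *m A = A, G *m A *m G = G,
      (A *m G)^T = A *m G & (G *m A)^T = G *m A].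

(* [pinvmx] of mxalgebra only satisfies the first equation, which would not
   make [X *m lse X M y] below the orthogonal projection of y. *)
Definition mpinv m n (A : 'M[R]_(m, n)) : 'M[R]_(n, m) :=
  xget 0 [set G | penrose A G].

Lemma penrose_uniq m n (A : 'M[R]_(m, n)) (G H : 'M[R]_(n, m)) :
  penrose A G -> penrose A H -> G = H.
Proof.
move=> [AGA GAG sAG sGA] [AHA HAH sAH sHA].
have AGH : A *m G = A *m H.
  rewrite -[LHS]sAG -{1}AHA -[A *m H *m A *m G]mulmxA trmx_mul sAG sAH.
  by rewrite mulmxA AGA.
have GAH : G *m A = H *m A.
  rewrite -[LHS]sGA -{1}AHA !mulmxA -[G *m A *m H *m A]mulmxA trmx_mul sGA sHA.
  by rewrite -mulmxA [A *m (G *m A)]mulmxA AGA.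
by rewrite -GAG GAH -mulmxA AGH mulmxA HAH.
Qed.

Lemma gram_unit m n (A : 'M[R]_(m, n)) :
  row_free A -> A *m A^T \in unitmx.
Proof.
move=> fA; rewrite -row_free_unit; apply/row_freeP.
suff /row_freeP[B AB] : row_free (A *m A^T) by exists B.
rewrite -kermx_eq0; apply/eqP/row_matrixP => i; rewrite row0.
set u := row i _.
have uAA : u *m (A *m A^T) = 0 by apply/sub_kermxP/row_sub.
have uA0 : u *m A = 0.
  have : (u *m A) *m (u *m A)^T = 0.
    by rewrite trmx_mul !mulmxA -(mulmxA u) uAA mul0mx.
  move=> /matrixP /(_ ord0 ord0); rewrite !mxE => /eqP.
  rewrite psumr_eq0 => [/allP h|j _]; last by rewrite [X in _ * X]mxE -expr2 sqr_ge0.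
  apply/rowP => j; rewrite [RHS]mxE.
  move: (h j (mem_index_enum j)); rewrite implyTb [X in _ * X]mxE -expr2.
  by rewrite sqrf_eq0 => /eqP.
by apply: (row_free_inj fA); rewrite uA0 mul0mx.
Qed.

Lemma penrose_full_rank m n k (C : 'M[R]_(m, k)) (F : 'M[R]_(k, n)) :
  row_free C^T -> row_free F ->
  penrose (C *m F) (F^T *m invmx (F *m F^T) *m (invmx (C^T *m C) *m C^T)).
Proof.
move=> fC fF; have uF := gram_unit fF.
have uC := gram_unit fC; rewrite trmxK in uC.
set f := invmx (F *m F^T); set c := invmx (C^T *m C).
have sf : f^T = f by rewrite /f trmx_inv trmx_mul trmxK.
have sc : c^T = c by rewrite /c trmx_inv trmx_mul trmxK.
have AG : C *m F *m (F^T *m f *m (c *m C^T)) = C *m c *m C^T.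
  by rewrite !mulmxA -(mulmxA C F) -(mulmxA C (F *m _)) mulmxV // mulmx1.
have GA : F^T *m f *m (c *m C^T) *m (C *m F) = F^T *m f *m F.
  by rewrite !mulmxA -(mulmxA _ C^T C) -(mulmxA _ c) mulVmx // mulmx1.
split.
- by rewrite AG !mulmxA -(mulmxA _ C^T C) -(mulmxA _ c) mulVmx // mulmx1.
- rewrite GA !mulmxA -(mulmxA _ F F^T) -(mulmxA _ (F *m F^T)) mulmxV //.
  by rewrite mulmx1.
- by rewrite AG !trmx_mul trmxK sc mulmxA.
- by rewrite GA !trmx_mul trmxK sf mulmxA.
Qed.

Lemma mpinvP m n (A : 'M[R]_(m, n)) : penrose A (mpinv A).
Proof.
apply: (@xgetPex _ _ [set G | penrose A G]).
exists ((row_base A)^T *m invmx (row_base A *m (row_base A)^T) *m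
        (invmx ((col_base A)^T *m col_base A) *m (col_base A)^T)).
rewrite /= -{1}(mulmx_base A); apply: penrose_full_rank.
  by rewrite /row_free mxrank_tr; exact: col_base_full.
exact: row_base_free.
Qed.

End MoorePenrose.

Section Model.
Variable R : realType.

(* The norm [`| v |] provided on matrices is the max norm. *)
Definition sqnorm n (v : 'cV[R]_n) : R := \sum_i v i ord0 ^+ 2.

Variables n p : nat.
Implicit Types (X : 'M[R]_(n, p)) (M : {set 'I_p}) (y : 'cV[R]_n).

Definition columns_free X r : Prop :=
  forall M, #|M| = r -> free [seq col j X | j <- enum M].

Definition Dmx M : 'M[R]_p := diag_mx (\row_j (j \in M)%:R).

Definition lse X M y : 'cV[R]_p :=
  mpinv (Dmx M *m X^T *m X *m Dmx M) *m Dmx M *m X^T *m y.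

(* The predictor sets of size r are all kept: they share the same fit and the
   same penalty [Pen r], and so stand for the single saturated model. *)
Definition models r : set {set 'I_p} := [set M | (#|M| <= r)%N].

Definition Pen r (sigma gamma : R) (prior : nat -> R) (k : nat) : R :=
  2 * sigma ^+ 2 * (1 + gamma^-1) *
  ln ((if (k < r)%N then 'C(p, k)%:R else 1) *
      (prior k)^-1 * (1 + gamma) `^ (k%:R / 2)).

Definition MAP_criterion X r (sigma gamma : R) (prior : nat -> R) y M : R :=
  sqnorm (y - X *m lse X M y) + Pen r sigma gamma prior #|M|.

(* Any rule for breaking ties is allowed. *)
Definition MAP_selector X r (sigma gamma : R) (prior : nat -> R)
    (Mhat : 'cV[R]_n -> {set 'I_p}) : Prop :=
  forall y, models r (Mhat y) /\
    forall M, models r M ->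
      MAP_criterion X r sigma gamma prior y (Mhat y) <=
      MAP_criterion X r sigma gamma prior y M.

(* A probability distribution on {0, ..., r} charging every point; the values
   of [prior] beyond r are irrelevant. *)
Definition positive_pmf r (prior : nat -> R) : Prop :=
  (forall k, (k <= r)%N -> 0 < prior k) /\ \sum_(k < r.+1) prior k = 1.

Definition cgam (gamma : R) : R := 8 * (gamma + 3 / 4) ^+ 2.

End Model.

Section Noise.
Context d (T : measurableType d) (R : realType) (P : probability T R).

Definition mutually_independent (I : finType) (Z : I -> {RV P >-> R}) : Prop :=
  forall (J : {set I}) (A : I -> set R), (forall i, measurable (A i)) ->
    P (\bigcap_(i in [set` J]) (Z i @^-1` A i)) =
    (\prod_(i in J) P (Z i @^-1` A i))%E.

(* eps ~ N(0, sigma^2 I_n); the second argument of [normal_prob] is the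
   standard deviation. *)
Definition gaussian_noise n (sigma : R) (eps : 'I_n -> {RV P >-> R}) : Prop :=
  (forall i (A : set R), measurable A ->
     distribution P (eps i) A = normal_prob 0 sigma A) /\
  mutually_independent eps.

Definition response n p (X : 'M[R]_(n, p)) (beta : 'cV[R]_p)
    (eps : 'I_n -> {RV P >-> R}) (w : T) : 'cV[R]_n :=
  X *m beta + \col_i eps i w.

End Noise.

(* Main.v *)
Require Import Defs.
From HB Require Import structures.
From mathcomp Require Import all_boot all_order all_algebra.
From mathcomp Require Import all_classical all_reals all_analysis.
From mathcomp Require Import measurable_realfun lra.

Set Implicit Arguments.
Unset Strict Implicit.
Unset Printing Implicit Defensive.

Import Order.TTheory GRing.Theory Num.Theory.

Local Open Scope classical_set_scope.
Local Open Scope ring_scope.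

(** Write [f = X beta], [y = f + eps] and let [H_M] be the orthogonal projection
    onto the columns of [X] in [M].  The loss of [M] is
    [|(1 - H_M) f|^2 + |H_M eps|^2], so comparing the MAP criterion at the
    selected model [M'] and at an arbitrary [M] gives, for a small [delta > 0]
    depending on [gamma],
    [delta * loss M' <=
     |(1 - H_M) f|^2 + 2 <(1 - H_M) f, eps> + Pen M + excess M'],
    where [excess M'] is a quadratic in [eps] minus [Pen M'].  The exponential
    moment of [excess M'] is computed exactly; the condition on [c(gamma)] leaves
    just enough room to bound it by [prior |M'| / 'C(p, |M'|)], and these bounds
    sum to [\sum_k prior k = 1].  Hence [excess M'] costs at most a constant times
    [sigma ^+ 2] in expectation, while the lower bounds on the prior give
    [Pen M <= K sigma^2 (|M| + 1) ln p].

    All moments come from exponentials of linear forms.  Squares are linearised by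
    [exp (x^2 / 2) = E_g exp (g x)], [g] standard normal, so that Tonelli reduces
    the exponential moment of [|H_M eps|^2] to one-dimensional integrals, and
    neither the rotation invariance nor the covariance of [eps] is needed. *)

(** * Inner products and orthogonal projections *)

Section InnerProduct.
Variables (R : realType) (n : nat).
Implicit Types (u v w : 'cV[R]_n) (H : 'M[R]_n).

Definition dotv u v : R := (u^T *m v) ord0 ord0.

Lemma dotvE u v : dotv u v = \sum_i u i ord0 * v i ord0.
Proof. by rewrite /dotv mxE; apply: eq_bigr => i _; rewrite mxE. Qed.

Lemma dotvC u v : dotv u v = dotv v u.
Proof. by rewrite !dotvE; apply: eq_bigr => i _; rewrite mulrC. Qed.

Lemma dotvDr u v w : dotv u (v + w) = dotv u v + dotv u w.
Proof. by rewrite /dotv mulmxDr mxE. Qed.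

Lemma dotvDl u v w : dotv (v + w) u = dotv v u + dotv w u.
Proof. by rewrite dotvC dotvDr !(dotvC u). Qed.

Lemma dotvZr u c v : dotv u (c *: v) = c * dotv u v.
Proof. by rewrite /dotv -scalemxAr mxE. Qed.

Lemma dotvZl u c v : dotv (c *: v) u = c * dotv v u.
Proof. by rewrite dotvC dotvZr dotvC. Qed.

Lemma dotvNr u v : dotv u (- v) = - dotv u v.
Proof. by rewrite -scaleN1r dotvZr mulN1r. Qed.

Lemma dotvNl u v : dotv (- v) u = - dotv v u.
Proof. by rewrite dotvC dotvNr dotvC. Qed.

Lemma dot0v u : dotv 0 u = 0.
Proof. by rewrite /dotv trmx0 mul0mx mxE. Qed.

Lemma dotv_mulmx H u v : dotv u (H *m v) = dotv (H^T *m u) v.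
Proof. by rewrite /dotv trmx_mul trmxK mulmxA. Qed.

Lemma dotv_rank1 u v w : dotv w (u *m u^T *m v) = dotv u w * dotv u v.
Proof.
rewrite /dotv !mulmxA -mulmxA [LHS]mxE big_ord1.
by rewrite -/(dotv w u) (dotvC w u).
Qed.

Lemma sqnorm_dotv v : sqnorm v = dotv v v.
Proof. by rewrite dotvE; apply: eq_bigr => i _; rewrite expr2. Qed.

Lemma sqnorm_ge0 v : 0 <= sqnorm v.
Proof. by apply: sumr_ge0 => i _; exact: sqr_ge0. Qed.

Lemma sqnorm_eq0 v : sqnorm v = 0 -> v = 0.
Proof.
move=> /eqP; rewrite psumr_eq0 => [/allP h|i _]; last exact: sqr_ge0.
apply/colP => i; rewrite mxE; apply/eqP; rewrite -sqrf_eq0.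
exact: (h i (mem_index_enum i)).
Qed.

Lemma sqnormZ c v : sqnorm (c *: v) = c ^+ 2 * sqnorm v.
Proof. by rewrite !sqnorm_dotv dotvZr dotvZl mulrA expr2. Qed.

Definition orthoproj H : Prop := H^T = H /\ H *m H = H.

Lemma orthoproj_dotv H u v :
  orthoproj H -> dotv (H *m u) (H *m v) = dotv u (H *m v).
Proof. by move=> [sH iH]; rewrite dotv_mulmx sH mulmxA iH dotv_mulmx sH. Qed.

Lemma orthoproj_sqnorm H v : orthoproj H -> sqnorm (H *m v) = dotv v (H *m v).
Proof. by move=> pH; rewrite sqnorm_dotv orthoproj_dotv. Qed.

Lemma orthoproj_compl H : orthoproj H -> orthoproj (1%:M - H).
Proof.
move=> [sH iH]; split; first by rewrite linearB /= trmx1 sH.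
by rewrite mulmxBl mul1mx mulmxBr mulmx1 iH subrr subr0.
Qed.

(** The term [sqnorm e] is the same for every projection, so it cancels when the MAP criteria of two
    models are compared. *)
Lemma orthoproj_residual H f e : orthoproj H ->
  sqnorm (f + e - H *m (f + e)) =
  sqnorm ((1%:M - H) *m f) + 2 * dotv ((1%:M - H) *m f) e + sqnorm e
  - sqnorm (H *m e).
Proof.
move=> pH; have pC := orthoproj_compl pH.
have -> : f + e - H *m (f + e) = (1%:M - H) *m (f + e).
  by rewrite mulmxBl mul1mx.
rewrite (orthoproj_sqnorm _ pH) !(orthoproj_sqnorm _ pC) (sqnorm_dotv e).
rewrite !mulmxDr !dotvDr !dotvDl.
rewrite [dotv f ((1%:M - H) *m e)]dotv_mulmx (proj1 pC).
rewrite (dotvC e ((1%:M - H) *m f)).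
rewrite [dotv e ((1%:M - H) *m e)]dotv_mulmx (proj1 pC).
rewrite [(1%:M - H) *m e]mulmxBl mul1mx dotvDl dotvNl.
by rewrite [dotv (H *m e) e]dotvC; lra.
Qed.

Lemma orthoproj_loss H f e : orthoproj H ->
  sqnorm (H *m (f + e) - f) = sqnorm ((1%:M - H) *m f) + sqnorm (H *m e).
Proof.
move=> pH; have pC := orthoproj_compl pH; have [sH iH] := pH.
have -> : H *m (f + e) - f = H *m e - (1%:M - H) *m f.
  by rewrite mulmxBl mul1mx mulmxDr opprB (addrC (H *m f)) addrA.
rewrite sqnorm_dotv dotvDl dotvDr !dotvNl !dotvDr !dotvNr -!sqnorm_dotv.
have -> : dotv (H *m e) ((1%:M - H) *m f) = 0.
  by rewrite dotv_mulmx (proj1 pC) mulmxA mulmxBl mul1mx iH subrr mul0mx dot0v.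
rewrite (dotvC ((1%:M - H) *m f)).
have -> : dotv (H *m e) ((1%:M - H) *m f) = 0.
  by rewrite dotv_mulmx (proj1 pC) mulmxA mulmxBl mul1mx iH subrr mul0mx dot0v.
by lra.
Qed.

(** Symmetry and idempotence make the trace the sum of the squares of all entries. *)
Lemma orthoproj_tr0 H : orthoproj H -> \tr H = 0 -> H = 0.
Proof.
move=> [sH iH] t0; apply/matrixP => i j; rewrite mxE.
have : \sum_k \sum_l H k l ^+ 2 = 0.
  rewrite -[RHS]t0 -[in RHS]iH /mxtrace; apply: eq_bigr => k _;
    rewrite [RHS]mxE.
  by apply: eq_bigr => l _; rewrite expr2; congr (_ * _);
    rewrite -[in LHS]sH mxE.
move=> /eqP; rewrite psumr_eq0 => [/allP h|k _]; last first.
  by apply: sumr_ge0 => l _; exact: sqr_ge0.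
have := h i (mem_index_enum i); rewrite implyTb psumr_eq0 => [/allP h2|l _];
  last exact: sqr_ge0.
by have := h2 j (mem_index_enum j); rewrite implyTb sqrf_eq0 => /eqP.
Qed.

Lemma orthoproj_diag H i : orthoproj H -> H i i = sqnorm (col i H).
Proof.
move=> [sH iH]; rewrite -[in LHS]iH mxE; apply: eq_bigr => l _.
by rewrite mxE expr2; congr (_ * _); rewrite -[in LHS]sH mxE.
Qed.

(** One step of a diagonalisation that avoids eigenvalues: each column of [H] is fixed by [H], and
    column [i] has squared norm [H i i], so a nonzero diagonal entry yields a unit vector [q] whose
    rank-one projection can be subtracted. *)
Lemma orthoproj_split H : orthoproj H -> \tr H != 0 ->
  exists q, [/\ sqnorm q = 1, orthoproj (H - q *m q^T),
                \tr (H - q *m q^T) = \tr H - 1 & (H - q *m q^T) *m q = 0].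
Proof.
move=> pH tn0; have [sH iH] := pH.
have [i Hii] : exists i, H i i != 0.
  apply/existsP; apply: contraR tn0 => /existsPn h;
    rewrite /mxtrace big1 // => i _.
  by apply/eqP; move: (h i); rewrite negbK.
have Hgt0 : 0 < H i i by rewrite lt_neqAle eq_sym Hii orthoproj_diag
  ?sqnorm_ge0.
pose q := (Num.sqrt (H i i))^-1 *: col i H.
have q1 : sqnorm q = 1.
  by rewrite sqnormZ -orthoproj_diag // exprVn sqr_sqrtr ?ltW // mulVf.
have Hq : H *m q = q by rewrite /q -scalemxAr colE mulmxA iH.
have qH : q^T *m H = q^T by rewrite -{1}sH -trmx_mul Hq.
have qq : q^T *m q = 1%:M.
  by apply/matrixP => a b; rewrite !ord1 -/(dotv q q) -sqnorm_dotv q1 mxE.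
exists q; split => //.
- split; first by rewrite linearB /= trmx_mul trmxK sH.
  rewrite mulmxBl !mulmxBr iH mulmxA Hq -!mulmxA (mulmxA q^T) qq mul1mx qH.
  by rewrite subrr subr0.
- by rewrite linearB /= mxtrace_mulC qq mxtrace1.
- by rewrite mulmxBl Hq -mulmxA qq mulmx1 subrr.
Qed.

Definition orthonormal_family (k : nat) (q : nat -> 'cV[R]_n) : Prop :=
  forall i j, (i < k)%N -> (j < k)%N -> dotv (q i) (q j) = (i == j)%:R.

Lemma orthoproj_basis k H : orthoproj H -> \tr H = k%:R ->
  exists2 q, orthonormal_family k q & H = \sum_(i < k) q i *m (q i)^T.
Proof.
elim: k H => [|k IH] H pH tH.
  by exists (fun=> 0) => //; rewrite big_ord0 (orthoproj_tr0 pH).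
have [|q [q1 pH' tH' H'q]] := orthoproj_split pH; first by rewrite tH pnatr_eq0.
have [|q' oq' H'E] := IH _ pH';
  first by rewrite tH' tH mulrS addrAC subrr add0r.
(* [q' i] lies in the range of the symmetric matrix [H - q *m q^T], which kills [q]. *)
have qq' i : (i < k)%N -> dotv (q' i) q = 0.
  move=> ik; have : (H - q *m q^T) *m q' i = q' i.
    rewrite H'E mulmx_suml (bigD1 (Ordinal ik)) //= big1 ?addr0 => [|j ji].
      rewrite -mulmxA; have -> : (q' i)^T *m q' i = 1%:M.
        by apply/matrixP => a b; rewrite !ord1 -/(dotv _ _) oq' // eqxx mxE.
      by rewrite mulmx1.
    rewrite -mulmxA; have -> : (q' j)^T *m q' i = 0; last by rewrite mulmx0.
    apply/matrixP => a b; rewrite !ord1 -/(dotv _ _) oq' // mxE.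
    by rewrite (negbTE (_ : nat_of_ord j != i)).
  by move=> <-; rewrite -{1}(proj1 pH') -dotv_mulmx H'q dotvC dot0v.
exists (fun i => if (i < k)%N then q' i else q); last first.
  rewrite big_ord_recr /= ltnn; under eq_bigr do rewrite ltn_ord.
  by rewrite -H'E subrK.
move=> i j; rewrite !ltnS => ik jk; have [ik'|ik'] := ltnP i k;
  have [jk'|jk'] := ltnP j k.
- exact: oq'.
- by rewrite qq' // (_ : (i == j) = false) //; apply/negbTE/eqP => ij;
    move: jk'; rewrite -ij leqNgt ik'.
- by rewrite dotvC qq' // (_ : (i == j) = false) //; apply/negbTE/eqP => ij;
    move: ik'; rewrite ij leqNgt jk'.
- by rewrite -sqnorm_dotv q1 (_ : i = j) ?eqxx //; apply/eqP;
    rewrite eqn_leq (leq_trans ik) // (leq_trans jk).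
Qed.

Lemma sqnorm_basis k q H v : orthoproj H -> H = \sum_(i < k) q i *m (q i)^T ->
  sqnorm (H *m v) = \sum_(i < k) dotv (q i) v ^+ 2.
Proof.
move=> pH HE; rewrite (orthoproj_sqnorm _ pH) HE.
rewrite mulmx_suml {1}/dotv mulmx_sumr summxE; apply: eq_bigr => i _.
by rewrite -[LHS]/(dotv _ _) dotv_rank1 expr2.
Qed.

(** In a full-rank factorisation [H = C *m F], idempotence reads [C F C F = C F]; cancelling [C] on
    the left and [F] on the right leaves [F C = 1], whose trace is the rank. *)
Lemma orthoproj_trE H : orthoproj H -> \tr H = (\rank H)%:R.
Proof.
move=> [_ iH]; rewrite -{1}(mulmx_base H) mxtrace_mulC.
suff -> : row_base H *m col_base H = 1%:M by rewrite mxtrace1.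
have fC : row_free (col_base H)^T by rewrite /row_free mxrank_tr;
  exact: col_base_full.
apply: (row_free_inj (row_base_free H)); rewrite mul1mx.
apply: trmx_inj; apply: (row_free_inj fC); rewrite -!trmx_mul; congr (_^T).
by rewrite -mulmxA mulmx_base mulmxA mulmx_base iH.
Qed.

End InnerProduct.

(** * The least squares fit as an orthogonal projection *)

Section LeastSquaresFit.
Variables (R : realType) (n p : nat).
Implicit Types (X : 'M[R]_(n, p)) (M : {set 'I_p}).

Lemma gram_eq0 m k (C : 'M[R]_(m, k)) : C^T *m C = 0 -> C = 0.
Proof.
move=> CC; apply/matrixP => i j; rewrite mxE.
have /sqnorm_eq0 /colP/(_ i) : sqnorm (col j C) = 0; last by rewrite !mxE.
transitivity ((C^T *m C) j j); last by rewrite CC mxE.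
by rewrite mxE; apply: eq_bigr => l _; rewrite !mxE expr2.
Qed.

Lemma penrose_tr m k (A : 'M[R]_(m, k)) (G : 'M[R]_(k, m)) :
  penrose A G -> penrose A^T G^T.
Proof.
move=> [h1 h2 h3 h4]; split; rewrite -?trmx_mul ?trmxK.
- by rewrite mulmxA h1.
- by rewrite mulmxA h2.
- by rewrite h4.
- by rewrite h3.
Qed.

Lemma tr_Dmx M : (Dmx R M)^T = Dmx R M.
Proof. exact: tr_diag_mx. Qed.

Lemma Dmx_idem M : Dmx R M *m Dmx R M = Dmx R M.
Proof.
rewrite /Dmx mulmx_diag; congr diag_mx; apply/rowP => j; rewrite !mxE.
by case: (j \in M); rewrite ?mulr1 ?mulr0.
Qed.

Lemma mxtrace_Dmx M : \tr (Dmx R M) = #|M|%:R.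
Proof.
rewrite mxtrace_diag; under eq_bigr do rewrite mxE.
by rewrite -sumr_const [RHS]big_mkcond; apply: eq_bigr => i _; case: (i \in M).
Qed.

Definition fit X M : 'M[R]_n :=
  X *m mpinv (Dmx R M *m X^T *m X *m Dmx R M) *m Dmx R M *m X^T.

Lemma mulmx_lse X M y : X *m lse X M y = fit X M *m y.
Proof. by rewrite /lse /fit !mulmxA. Qed.

Section Projection.
Variables (X : 'M[R]_(n, p)) (M : {set 'I_p}).
Let D := Dmx R M.
Let A := D *m X^T *m X *m D.
Let G := mpinv A.

Let A_sym : A^T = A.
Proof. by rewrite /A !trmx_mul trmxK tr_Dmx !mulmxA. Qed.

(** [A] is symmetric, so [G^T] solves the same Penrose equations as [G], and uniqueness applies. *)
Let G_sym : G^T = G.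
Proof. by apply: (penrose_uniq _ (mpinvP A)); rewrite -{1}A_sym;
  exact/penrose_tr/mpinvP. Qed.

(** The symmetry of [G A] turns [G = G A G] into [A G G], whose leading factor absorbs [D]. *)
Let DG : D *m G = G.
Proof.
have [_ h2 _ h4] := mpinvP A; rewrite -/G in h2 h4.
by rewrite -h2 -h4 trmx_mul A_sym G_sym /A !mulmxA Dmx_idem.
Qed.

Let GD : G *m D = G.
Proof. by rewrite -[LHS]trmxK trmx_mul G_sym tr_Dmx DG G_sym. Qed.

Let fit_G : fit X M = X *m G *m X^T.
Proof. by rewrite /fit -/D -/A -/G -(mulmxA X) GD. Qed.

Lemma orthoproj_fit : orthoproj (fit X M).
Proof.
have [_ h2 _ _] := mpinvP A; rewrite -/G in h2.
rewrite fit_G; split; first by rewrite !trmx_mul trmxK G_sym mulmxA.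
rewrite !mulmxA; congr (_ *m _); rewrite -[in RHS]h2 -{1}GD -{2}DG /A.
by rewrite !mulmxA.
Qed.

(** [A] is the Gram matrix of [X D]. The Gram matrix of [X D (G A - 1)] thus contains the factor
    [A (G A - 1)], which is zero by the first Penrose equation. *)
Let XD_GA : X *m D *m (G *m A) = X *m D.
Proof.
have [h1 _ _ _] := mpinvP A; rewrite -/G in h1.
apply/eqP; rewrite -subr_eq0 -{2}[X *m D]mulmx1 -mulmxBr; apply/eqP.
apply: gram_eq0; rewrite trmx_mul trmx_mul tr_Dmx -mulmxA.
have -> : D *m X^T *m (X *m D *m (G *m A - 1%:M)) = A *m (G *m A - 1%:M).
  by rewrite mulmxA; congr (_ *m _); rewrite /A !mulmxA.
by rewrite mulmxBr mulmx1 [A *m (G *m A)]mulmxA h1 subrr mulmx0.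
Qed.

Lemma fit_range : exists W, fit X M = X *m W.
Proof. by exists (G *m X^T); rewrite fit_G mulmxA. Qed.

Lemma fit_fix : fit X M *m (X *m Dmx R M) = X *m Dmx R M.
Proof.
rewrite -[RHS]XD_GA fit_G -/D -[X *m D *m _]mulmxA [D *m _]mulmxA DG /A.
by rewrite -[in LHS]GD !mulmxA.
Qed.

(** The assumption is linear independence of the columns of [X] in [M], phrased on vectors supported
    in [M]. *)
Lemma mxtrace_fit :
  (forall z : 'cV[R]_p, X *m (Dmx R M *m z) = 0 -> Dmx R M *m z = 0) ->
  \tr (fit X M) = #|M|%:R.
Proof.
move=> inj; rewrite fit_G -mulmxA mxtrace_mulC -mulmxA.
have -> : \tr (G *m (X^T *m X)) = \tr (G *m A).
  rewrite -[in LHS]DG -[in LHS]GD -(mulmxA D) mxtrace_mulC.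
  by rewrite /A !mulmxA.
(* [G A] is a projection whose range is that of [D]. *)
have DGA : D *m (G *m A) = D.
  apply/eqP; rewrite -subr_eq0 -{2}[D]mulmx1 -mulmxBr; set Z := G *m A - 1%:M.
  have XDZ : X *m D *m Z = 0 by rewrite mulmxBr XD_GA mulmx1 subrr.
  apply/eqP/matrixP => i j; rewrite [RHS]mxE.
  have /inj : X *m (D *m col j Z) = 0 by rewrite colE !mulmxA XDZ mul0mx.
  by rewrite -/D colE mulmxA -colE => /colP/(_ i); rewrite !mxE.
by rewrite -DG -mulmxA DGA mxtrace_Dmx.
Qed.

End Projection.

(** Freeness is only given for sets of exactly [r] predictors, so [M] is enlarged to such a set
    [M']; a relation among the columns in [M] is a relation over [M'] with zero coefficients outside
    [M]. *)
Lemma columns_free_inj X r M : columns_free X r -> (#|M| <= r <= p)%N ->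
  forall z : 'cV[R]_p, X *m (Dmx R M *m z) = 0 -> Dmx R M *m z = 0.
Proof.
move=> Xr /andP[Mr rp] z Xz.
(* Listing [M] before its complement makes the first [r] entries contain [M]. *)
pose e := enum M ++ enum (~: M).
have ue : uniq e.
  rewrite cat_uniq !enum_uniq andbT /=; apply/hasPn => x.
  by rewrite !mem_enum inE.
have se : size e = p by rewrite size_cat -!cardE cardsC card_ord.
pose M' := [set x in take r e].
have cM' : #|M'| = r by rewrite cardsE (card_uniqP (take_uniq _ ue))
  size_takel // se.
have MM' j : j \in M -> j \in M'.
  rewrite inE -mem_enum => jM; rewrite take_cat -cardE.
  case: ltngtP Mr => // [Mr|->] _; last by rewrite subnn take0 cats0.
  by rewrite mem_cat jM.
have DzN j : j \notin M -> (Dmx R M *m z) j ord0 = 0.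
  by move=> /negbTE jM; rewrite /Dmx mul_diag_mx !mxE jM mul0r.
have /(@freeP _ _ _ (in_tuple _)) fr := Xr _ cM'.
set u := Dmx R M *m z in Xz DzN *; apply/colP => j; rewrite [RHS]mxE.
have [jM|/DzN//] := boolP (j \in M); have jM' := MM' _ jM.
have jlt : (index j (enum M') < size [seq col j X | j <- enum M'])%N.
  by rewrite size_map index_mem mem_enum.
have := fr (fun i => u (nth j (enum M') i) ord0) _ (Ordinal jlt).
rewrite nth_index ?mem_enum //; apply.
transitivity (\sum_(x <- enum M') u x ord0 *: col x X).
  rewrite [RHS](big_nth j) big_mkord -(size_map (fun l => col l X)).
  apply: eq_bigr => i _ /=; rewrite (nth_map j) //.
  by rewrite -(size_map (fun l => col l X)).
rewrite big_enum /= -[RHS]Xz; apply/colP => i; rewrite summxE [RHS]mxE.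
rewrite big_mkcond; apply: eq_bigr => l _; case: ifPn => lM;
  first by rewrite !mxE mulrC.
by rewrite DzN ?mulr0 //; apply: contra lM => /MM'.
Qed.

(** The projection onto all columns absorbs [fit X M] on both sides, so their difference is again a
    projection. Its trace is [r - r], hence it vanishes. *)
Lemma fit_saturated X r M : \rank X = r -> columns_free X r -> #|M| = r ->
  fit X M = fit X [set: 'I_p]%SET.
Proof.
move=> rX Xr cM; have rp : (r <= p)%N by rewrite -rX rank_leq_col.
have pF := orthoproj_fit X M; have pT := orthoproj_fit X [set: 'I_p]%SET.
have D1 : Dmx R [set: 'I_p]%SET = 1%:M.
  by apply/matrixP => i j; rewrite !mxE inE.
have TX : fit X [set: 'I_p]%SET *m X = X by have := fit_fix X [set: 'I_p]%SET;
  rewrite D1 mulmx1.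
have [W FW] := fit_range X M.
have TF : fit X [set: 'I_p]%SET *m fit X M = fit X M by rewrite FW mulmxA TX.
have FT : fit X M *m fit X [set: 'I_p]%SET = fit X M.
  by rewrite -[RHS](proj1 pF) -[in RHS]TF trmx_mul (proj1 pF) (proj1 pT).
apply/esym/eqP; rewrite -subr_eq0; apply/eqP/orthoproj_tr0.
  split; first by rewrite linearB /= (proj1 pF) (proj1 pT).
  by rewrite mulmxBl !mulmxBr (proj2 pF) (proj2 pT) TF FT subrr subr0.
rewrite linearB /= (orthoproj_trE pT) mxtrace_fit ?cM; last first.
  by apply: columns_free_inj Xr _; rewrite cM leqnn.
suff -> : \rank (fit X [set: 'I_p]%SET) = r by rewrite subrr.
apply/eqP; rewrite -rX eqn_leq; apply/andP; split.
  by have [V ->] := fit_range X [set: 'I_p]%SET; exact: mxrankM_maxl.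
by rewrite -{1}TX mxrankM_maxl.
Qed.

End LeastSquaresFit.

(** * Independence and Gaussian exponential moments *)

Section WeightedTransfer.
Local Open Scope ereal_scope.
Context d1 d2 (T1 : measurableType d1) (T2 : measurableType d2) (R : realType).
Variables (mu : {measure set T2 -> \bar R}) (nu : {measure set T1 -> \bar R}).
Variables (phi : T2 -> T1) (g : T2 -> R) (c : R).
Hypothesis mphi : measurable_fun setT phi.
Hypothesis mg : measurable_fun setT g.
Hypothesis g0 : forall x, (0 <= g x)%R.
Hypothesis c0 : (0 <= c)%R.
Hypothesis gnu : forall A, measurable A ->
  \int[mu]_x (g x * \1_A (phi x))%:E = c%:E * nu A.

Import HBNNSimple.

Let transfer_nnsfun (h : {nnsfun T1 >-> R}) :
  \int[mu]_x (g x * h (phi x))%:E = c%:E * \int[nu]_y (h y)%:E.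
Proof.
have mind y : measurable_fun setT (fun x => \1_(h @^-1` [set y]) (phi x) : R).
  by apply: measurableT_comp => //; exact: measurable_indic.
rewrite integralT_nnsfun sintegralE ge0_mule_fsumr; last first.
  by move=> y; exact: nnsfun_mulemu_ge0.
transitivity (\int[mu]_x (\sum_(y \in range h)
    (g x * (y * \1_(h @^-1` [set y]) (phi x)))%:E)).
  apply: eq_integral => x _; rewrite /= fimfunE EFinM -fsumEFin //.
  rewrite ge0_mule_fsumr; last by move=> y; exact: nnfun_muleindic_ge0.
  by apply: eq_fsbigr => y _; rewrite EFinM.
rewrite ge0_integral_fsum //; last 2 first.
  by move=> y; apply/measurable_EFinP; do 2?apply: measurable_funM => //.
  by move=> y x _; rewrite EFinM mule_ge0 ?lee_fin //;
    exact: nnfun_muleindic_ge0.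
apply: eq_fsbigr => y /[!inE] -[t _ hy].
under eq_integral do rewrite mulrCA EFinM.
rewrite ge0_integralZl_EFin //; first by rewrite gnu // muleCA.
- by move=> x _; rewrite lee_fin mulr_ge0.
- by apply/measurable_EFinP; apply: measurable_funM.
- by rewrite -hy.
Qed.

(** Extends [gnu] from indicators to simple functions, then to nonnegative functions by monotone
    convergence. It serves three times: to integrate one factor out of an independent product ([g]
    the product of the others), to integrate against the normal density ([phi] the identity), and to
    pass from a noise coordinate to its law ([g = 1]). *)
Lemma ge0_integral_weighted_transfer (f : T1 -> R) :
  measurable_fun setT f -> (forall y, (0 <= f y)%R) ->
  \int[mu]_x (g x * f (phi x))%:E = c%:E * \int[nu]_y (f y)%:E.
Proof.
move=> mf f0; have mfE : measurable_fun setT (EFin \o f) by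
  exact/measurable_EFinP.
pose h := nnsfun_approx measurableT mfE.
have hf y : (EFin \o h ^~ y) @ \oo --> (f y)%:E.
  by apply: (cvg_nnsfun_approx (D := setT)) => // x _; rewrite lee_fin.
have ndh y : nondecreasing_seq (h ^~ y) by move=> a b ab;
  exact/lefP/nd_nnsfun_approx.
have L : \int[mu]_x (g x * h n (phi x))%:E @[n --> \oo]
    --> \int[mu]_x (g x * f (phi x))%:E.
  rewrite [X in _ --> X](_ : _ = \int[mu]_x limn (fun n => (g x * h n (phi
    x))%:E)).
    apply: cvg_monotone_convergence => //.
    - move=> n; apply/measurable_EFinP; apply: measurable_funM => //.
      exact: measurableT_comp.
    - by move=> n x _; rewrite lee_fin mulr_ge0.
    - by move=> x _ a b ab; rewrite lee_fin ler_wpM2l // ndh.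
  apply: eq_integral => x _; apply/esym/cvg_lim => //.
  by under eq_fun do rewrite EFinM; rewrite EFinM; apply: cvgeZl => //;
    exact: hf.
have Rr : c%:E * \int[nu]_y (h n y)%:E @[n --> \oo] --> c%:E * \int[nu]_y (f
  y)%:E.
  apply: cvgeZl => //.
  rewrite [X in _ --> X](_ : _ = \int[nu]_y limn (fun n => (h n y)%:E)).
    apply: cvg_monotone_convergence => //.
    - by move=> n; exact/measurable_EFinP.
    - by move=> n x _; rewrite lee_fin.
    - by move=> x _ a b ab; rewrite lee_fin ndh.
  by apply: eq_integral => y _; apply/esym/cvg_lim => //; exact: hf.
apply: (cvg_unique _ L); first exact: ereal_hausdorff.
have -> // : (fun n => \int[mu]_x (g x * h n (phi x))%:E) =
  (fun n => c%:E * \int[nu]_y (h n y)%:E).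
by apply/funext => n; exact: transfer_nnsfun.
Qed.

End WeightedTransfer.

Section Independence.
Context d (T : measurableType d) (R : realType) (P : probability T R).
Variables (I : finType) (Z : I -> {RV P >-> R}).

Lemma independent_integral_prod (f : I -> R -> R) (m : I -> R) :
  mutually_independent Z ->
  (forall i, measurable_fun setT (f i)) -> (forall i x, 0 <= f i x) ->
  (forall i, \int[P]_w (f i (Z i w))%:E = (m i)%:E)%E ->
  (\int[P]_w (\prod_i f i (Z i w))%:E = (\prod_i m i)%:E)%E.
Proof.
move=> indZ.
suff H (s : seq I) : forall (g : I -> R -> R) (m : I -> R),
    (forall i, i \notin s -> exists2 A, measurable A & g i = \1_A) ->
    (forall i, measurable_fun setT (g i)) -> (forall i x, 0 <= g i x) ->
    (forall i, \int[P]_w (g i (Z i w))%:E = (m i)%:E)%E ->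
    (\int[P]_w (\prod_i g i (Z i w))%:E = (\prod_i m i)%:E)%E.
  by move=> mf f0 fm; apply: (H (enum I)) => // i; rewrite mem_enum.
(* Induction on the indices [s] where the indicators given by independence
   have been replaced by arbitrary functions. *)
elim: s => [|k s IH] {}f {}m fA mf f0 fm.
  (* Base case: the product of indicators is the indicator of the intersection, and independence of
     events applies. *)
  have /choice[A Af] i : exists A, measurable A /\ f i = \1_A.
    by have [A mA ->] := fA i isT; exists A.
  have PA i : P (Z i @^-1` A i) = (m i)%:E.
    rewrite -fm (Af i).2 -(setIT (Z i @^-1` A i)) -integral_indic //.
    exact: measurable_funPTI (Af i).1.
  have := indZ finset.setT A (fun i => (Af i).1).
  have -> : (\prod_(i in finset.setT) P (Z i @^-1` A i))%E = (\prod_i m i)%:E.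
    rewrite big_mkcond /= (big_morph EFin EFinM erefl) //.
    by apply: eq_bigr => i _; rewrite finset.in_setT PA.
  move=> <-; rewrite -(setIT (\bigcap_(i in _) _)) -integral_indic //;
    last first.
    apply: fin_bigcap_measurable; first exact: finite_finset.
    by move=> i _; exact: measurable_funPTI (Af i).1.
  apply: eq_integral => w _; congr EFin; rewrite indicE.
  under eq_bigr do rewrite (Af _).2 indicE.
  have [wA|wA] := boolP (w \in _).
    apply: big1 => i _; rewrite mem_set //.
    by move: wA; rewrite inE => /(_ i); apply; rewrite /= finset.in_setT.
  have /existsP[i Hi] : [exists i, Z i w \notin A i].
    apply: contraR wA => /existsPn h; rewrite inE => i _ /=.
    by have := h i; rewrite negbK inE.
  by rewrite (bigD1 i) //= (negbTE Hi) mul0r.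
have m0 i : 0 <= m i.
  by rewrite -lee_fin -fm; apply: integral_ge0 => w _; rewrite lee_fin.
have mprod (Q : pred I) : measurable_fun setT
    (fun w => \prod_(i | Q i) f i (Z i w)).
  under eq_fun do rewrite -big_filter.
  by apply: measurable_prod => i _; exact: measurableT_comp.
rewrite (bigD1 k) //= mulrC EFinM.
under eq_integral do rewrite (bigD1 k) //= mulrC.
rewrite (@ge0_integral_weighted_transfer _ _ _ _ _ P (distribution P (Z k))
   (Z k)
   _ (\prod_(i | i != k) m i) _ (mprod _)) //.
- by rewrite ge0_integral_distribution //= ?fm //;
    [exact/measurable_EFinP|move=> y; rewrite lee_fin].
- by move=> w; apply: prodr_ge0.
move=> A mA.
(* The hypothesis of the transfer lemma is the same identity with an indicator as factor [k], which
   is an instance of the induction hypothesis. *)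
pose f' i := if i == k then \1_A : R -> R else f i.
pose m' i := if i == k then fine (distribution P (Z k) A) else m i.
have m'k : m' k = fine (distribution P (Z k) A) by rewrite /m' eqxx.
have f'k : f' k = \1_A by rewrite /f' eqxx.
have := IH f' m' _ _ _ _.
rewrite (bigD1 k) //= m'k.
have -> : \prod_(i | i != k) m' i = \prod_(i | i != k) m i.
  by apply: eq_bigr => i /negbTE ik; rewrite /m' ik.
have -> : (fun w => (\prod_i f' i (Z i w))%:E) =
    (fun w => (\prod_(i | i != k) f i (Z i w) * \1_A (Z k w))%:E).
  apply/funext => w; rewrite (bigD1 k) //= mulrC f'k; congr (_ * _)%:E.
  by apply: eq_bigr => i /negbTE ik; rewrite /f' ik.
rewrite mulrC EFinM fineK ?fin_num_measure //; apply.
- move=> i; rewrite /f'; case: eqP => [_ _|/eqP ik is_]; first by exists A.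
  by apply: fA; rewrite inE negb_or ik.
- by move=> i; rewrite /f'; case: eqP.
- by move=> i x; rewrite /f'; case: eqP.
- move=> i; rewrite /f' /m'; case: eqP => [->|_ //].
  rewrite fineK ?fin_num_measure // /distribution /pushforward.
  rewrite -[in RHS](setIT (Z k @^-1` A)) -integral_indic //.
  exact: measurable_funPTI.
Qed.

End Independence.

Section GaussianIntegrals.
Variable R : realType.
Local Notation mu := (@lebesgue_measure R).

Lemma ge0_integral_normal_prob (m s : R) (f : R -> R) :
  measurable_fun setT f -> (forall x, 0 <= f x) ->
  (\int[normal_prob m s]_x (f x)%:E =
   \int[mu]_x (normal_pdf m s x * f x)%:E)%E.
Proof.
move=> mf f0; rewrite -[LHS]mul1e; apply/esym.
apply: (@ge0_integral_weighted_transfer _ _ _ _ _ mu (normal_prob m s) id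
  (normal_pdf m s) 1) => //.
- exact: measurable_normal_pdf.
- by move=> x; exact: normal_pdf_ge0.
move=> A mA; rewrite mul1e /normal_prob [RHS]integral_mkcond.
apply: eq_integral => x _; rewrite patchE indicE.
by case: (x \in A); rewrite ?mulr1 ?mulr0.
Qed.

(** Completing the square: the tilted density is a multiple of another normal density, with
    precision lowered by [2 * tau], so its integral only needs total mass one. *)
Lemma normal_pdf_tilt (s s' b tau x : R) : 0 < s -> 0 < s' ->
  s'^-1 ^+ 2 = s^-1 ^+ 2 - 2 * tau ->
  normal_pdf 0 s x * expR (b * x + tau * x ^+ 2) =
  s' / s * expR (b ^+ 2 * s' ^+ 2 / 2) * normal_pdf (b * s' ^+ 2) s' x.
Proof.
move=> s0 s'0 ss'; rewrite !normal_pdfE ?gt_eqF // /normal_fun.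
have peak z : 0 < z -> normal_peak z = z^-1 * (Num.sqrt (pi *+ 2))^-1 :> R.
  move=> z0; rewrite /normal_peak -mulrnAr sqrtrM ?sqr_ge0 // sqrtr_sqr.
  by rewrite gtr0_norm // invfM.
rewrite !peak //; set K := (Num.sqrt _)^-1; set E1 := expR _; set E2 := expR _.
set E3 := expR _; set E4 := expR _.
have -> : s' / s * E3 * (s'^-1 * K * E4) = (s' * s'^-1) * (s^-1 * K * (E3 *
  E4)) by lra.
rewrite mulfV ?gt_eqF // mul1r -[LHS]mulrA; congr (_ * _).
rewrite /E1 /E2 /E3 /E4 -!expRD; congr expR.
have two (z w : R) : z / (w ^+ 2 *+ 2) = z * w^-1 ^+ 2 / 2.
  by rewrite -mulr_natr invfM exprVn mulrA.
rewrite !two ss' subr0; set w := s' ^+ 2.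
have wv : w * (s^-1 ^+ 2 - 2 * tau) = 1.
  by rewrite -ss' /w exprVn mulfV // sqrf_eq0 gt_eqF.
have -> : - (x - b * w) ^+ 2 * (s^-1 ^+ 2 - 2 * tau) =
  - x ^+ 2 * (s^-1 ^+ 2 - 2 * tau) + 2 * x * b * (w * (s^-1 ^+ 2 - 2 * tau))
  - b ^+ 2 * w * (w * (s^-1 ^+ 2 - 2 * tau)) by lra.
by rewrite wv; lra.
Qed.

Lemma integral_normal_exp_quad (s s' b tau : R) : 0 < s -> 0 < s' ->
  s'^-1 ^+ 2 = s^-1 ^+ 2 - 2 * tau ->
  (\int[normal_prob 0 s]_x (expR (b * x + tau * x ^+ 2))%:E =
   (s' / s * expR (b ^+ 2 * s' ^+ 2 / 2))%:E)%E.
Proof.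
move=> s0 s'0 ss'; rewrite ge0_integral_normal_prob; last 2 first.
- apply: measurableT_comp => //; apply: measurable_funD;
    apply: measurable_funM => //.
- by move=> x; exact: expR_ge0.
under eq_integral do rewrite (normal_pdf_tilt _ _ s0 s'0 ss') EFinM.
rewrite ge0_integralZl_EFin //.
- by rewrite integral_normal_pdf mule1.
- by move=> x _; rewrite lee_fin normal_pdf_ge0.
- by apply/measurable_EFinP; exact: measurable_normal_pdf.
- by rewrite mulr_ge0 ?expR_ge0 // divr_ge0 ?ltW.
Qed.

End GaussianIntegrals.

Section GaussianNoise.
Context d (T : measurableType d) (R : realType) (P : probability T R).
Variables (n : nat) (sigma : R) (eps : 'I_n -> {RV P >-> R}).
Hypothesis sigma0 : 0 < sigma.
Hypothesis Heps : gaussian_noise sigma eps.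

Let e (w : T) : 'cV[R]_n := \col_i eps i w.

Lemma measurable_dotv (u : 'cV[R]_n) :
  measurable_fun setT (fun w => dotv u (e w)).
Proof.
under eq_fun do rewrite dotvE.
apply: measurable_sum => i; apply: measurable_funM => //.
under eq_fun do rewrite mxE; exact: measurable_funP.
Qed.

Lemma integral_exp_linear (v : 'cV[R]_n) :
  (\int[P]_w (expR (dotv v (e w)))%:E = (expR (sigma ^+ 2 * sqnorm v /
    2))%:E)%E.
Proof.
have -> : expR (sigma ^+ 2 * sqnorm v / 2) =
    \prod_i expR (v i ord0 ^+ 2 * sigma ^+ 2 / 2).
  rewrite -expR_sum; congr expR; rewrite /sqnorm mulr_sumr mulr_suml.
  by apply: eq_bigr => i _; rewrite [_ * v i ord0 ^+ 2]mulrC.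
rewrite -(@independent_integral_prod _ _ _ _ _ eps
  (fun i x => expR (v i ord0 * x))).
- by apply: eq_integral => w _; rewrite dotvE expR_sum;
    under eq_bigr do rewrite mxE.
- exact: Heps.2.
- by move=> i; apply: measurableT_comp => //; exact: measurable_funM.
- by move=> i x; exact: expR_ge0.
move=> i; transitivity (\int[normal_prob 0 sigma]_x (expR (v i ord0 * x))%:E)%E.
  rewrite -[RHS]mul1e.
  rewrite -(@ge0_integral_weighted_transfer _ _ _ _ _ P (normal_prob 0 sigma)
    (eps i)
    (cst 1) 1) //.
  - by apply: eq_integral => w _; rewrite /= mul1r.
  - by have := measurable_funPT (eps i).
  - move=> A mA; rewrite mul1e; transitivity (P (eps i @^-1` A));
      last exact: Heps.1.
    rewrite -[in RHS](setIT (eps i @^-1` A)) -integral_indic //;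
      last exact: measurable_funPTI.
    by apply: eq_integral => w _; rewrite /= mul1r.
  - by apply: measurableT_comp => //; exact: measurable_funM.
have := @integral_normal_exp_quad _ sigma sigma (v i ord0) 0 sigma0 sigma0.
rewrite mulr0 subr0 divff ?gt_eqF // mul1r => /(_ erefl) <-.
by apply: eq_integral => x _; rewrite mul0r addr0.
Qed.

(** The induction is general in [v], which absorbs the multiple of [q k] created by linearising the
    last square; orthonormality keeps the new vector orthogonal to the remaining [q i]. *)
Lemma integral_exp_quadratic k (q : nat -> 'cV[R]_n) (v : 'cV[R]_n) (t : R) :
  0 <= t -> 2 * t * sigma ^+ 2 < 1 -> orthonormal_family k q ->
  (forall i, (i < k)%N -> dotv (q i) v = 0) ->
  (\int[P]_w (expR (t * (\sum_(i < k) dotv (q i) (e w) ^+ 2) + dotv v (e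
    w)))%:E =
   ((Num.sqrt (1 - 2 * t * sigma ^+ 2))^-1 ^+ k *
      expR (sigma ^+ 2 * sqnorm v / 2))%:E)%E.
Proof.
move=> t0 t1; elim: k v => [|k IH] v oq qv.
  under eq_integral do rewrite big_ord0 mulr0 add0r.
  by rewrite integral_exp_linear expr0 mul1r.
(* [expR (t * x^2)] is the integral of [expR (c * x * g)] over standard normal
   [g]. *)
set c := Num.sqrt (2 * t).
have c2 : c ^+ 2 = 2 * t by rewrite sqr_sqrtr // mulr_ge0.
pose F (z : T * R) : \bar R := (expR (t * (\sum_(i < k) dotv (q i) (e z.1) ^+
  2) +
   dotv (v + (c * z.2) *: q k) (e z.1)))%:E.
have FE w g : F (w, g) = (expR (t * (\sum_(i < k) dotv (q i) (e w) ^+ 2) +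
  dotv v (e w)) *
     expR (c * dotv (q k) (e w) * g + 0 * g ^+ 2))%:E.
  rewrite /F /= dotvDl dotvZl -expRD; congr (expR _)%:E; lra.
have mF : measurable_fun setT F.
  apply/measurable_EFinP; apply: measurableT_comp => //; apply: measurable_funD.
    apply: measurable_funM => //; apply: measurable_sum => i.
    apply: measurable_funX; apply: (measurableT_comp (measurable_dotv (q i))).
    exact: measurable_fst.
  under eq_fun do rewrite dotvDl dotvZl.
  apply: measurable_funD.
    by apply: (measurableT_comp (measurable_dotv v)); exact: measurable_fst.
  apply: measurable_funM; first by apply: measurable_funM => //;
    exact: measurable_snd.
  by apply: (measurableT_comp (measurable_dotv (q k))); exact: measurable_fst.
transitivity (\int[P]_w \int[normal_prob 0 1]_g F (w, g))%E.
  apply: eq_integral => w _; under [RHS]eq_integral do rewrite FE EFinM.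
  rewrite ge0_integralZl_EFin //; last first.
    apply/measurable_EFinP; apply: measurableT_comp => //.
    by apply: measurable_funD; apply: measurable_funM => //;
      apply: measurable_funM.
  rewrite (@integral_normal_exp_quad _ 1 1) ?mulr0 ?subr0 //.
  rewrite -EFinM divr1 mul1r -expRD big_ord_recr /= exprMn c2;
    congr (expR _)%:E.
  by rewrite expr1n; lra.
rewrite (@fubini_tonelli _ _ _ _ _ P (normal_prob 0 1) F) //; last first.
  by move=> z; rewrite lee_fin expR_ge0.
set a := Num.sqrt _.
have a0 : 0 < a by rewrite sqrtr_gt0; lra.
have a2 : a ^+ 2 = 1 - 2 * t * sigma ^+ 2 by rewrite sqr_sqrtr //; lra.
have oqk : orthonormal_family k q by move=> i j ik jk; apply: oq; exact: leqW.
(* By orthogonality [v + (c * g) *: q k] has squared norm [sqnorm v + 2 * t * g ^+ 2], which is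
   where the new quadratic exponent in [g] comes from. *)
transitivity (\int[normal_prob 0 1]_g ((a^-1 ^+ k * expR (sigma ^+ 2 * sqnorm
  v / 2))%:E *
   (expR (0 * g + (t * sigma ^+ 2) * g ^+ 2))%:E))%E.
  apply: eq_integral => g _; rewrite /F /= IH //; last first.
    move=> i ik; rewrite dotvDr dotvZr (qv i (leqW ik)) (oq i k (leqW ik)
      (ltnSn k)) (ltn_eqF ik).
    by rewrite mulr0 addr0.
  rewrite -EFinM; congr EFin; rewrite -[RHS]mulrA -expRD; congr (_ * expR _).
  rewrite !sqnorm_dotv dotvDl !dotvDr !dotvZr !dotvZl (dotvC v) (qv k) //
    (oq k k) // eqxx.
  have -> : c * g * (c * g * 1%:R) = c ^+ 2 * g ^+ 2 by lra.
  by rewrite c2; lra.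
rewrite ge0_integralZl_EFin //; last 2 first.
- apply/measurable_EFinP; apply: measurableT_comp => //.
  by apply: measurable_funD; apply: measurable_funM => //.
- by rewrite mulr_ge0 ?expR_ge0 ?exprn_ge0 ?invr_ge0 ?ltW.
(* The tilted standard normal has precision [a ^+ 2], so its standard deviation [a^-1] is the extra
   factor of the power [k.+1]. *)
rewrite (@integral_normal_exp_quad _ 1 a^-1) ?invr_gt0 //; last first.
  by rewrite invrK a2 invr1 expr1n; lra.
rewrite -EFinM expr0n /= mul0r mul0r expR0 mulr1 divr1 (exprS a^-1);
  congr EFin; lra.
Qed.

End GaussianNoise.

(** * Real inequalities *)

Section RealInequalities.
Variable R : realType.
Implicit Types x h gamma delta L : R.

Lemma expR_half_le2 : expR 2^-1 <= 2 :> R.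
Proof.
have := expR_ge1Dx (- 2^-1 : R); rewrite expRN => h.
have e0 := expR_gt0 (2^-1 : R).
have : expR 2^-1 * (1 + - 2^-1) <= expR 2^-1 * (expR 2^-1)^-1 :> R by rewrite
  ler_pM2l.
by rewrite mulfV ?gt_eqF //; lra.
Qed.

Lemma ln2_ge_half : 2^-1 <= ln 2 :> R.
Proof. by rewrite -[leLHS]expRK ler_ln ?posrE ?expR_gt0 // expR_half_le2. Qed.

(* With [a = expR (2 * h)], [b = a^-1] and [1 - b <= 2 * h], this is
   [0 <= (1 - b)^2 ((a - 2)^2 + 1)]. *)
Lemma sqr_expR_lower_pos h : 0 <= h ->
  3 / 8 * (expR (2 * h) + expR (- (2 * h))) <=
  h ^+ 2 + (expR (4 * h) + expR (- (4 * h))) / 16 + 5 / 8.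
Proof.
move=> h0.
have -> : 4 * h = 2 * h + 2 * h by lra.
rewrite opprD !expRD; set a := expR (2 * h); set b := expR (- (2 * h)).
have ab : a * b = 1 by rewrite /a /b -expRD subrr expR0.
have a2b : a * a * b = a by rewrite -mulrA ab mulr1.
have ab2 : a * b * b = b by rewrite ab mul1r.
have a2b2 : a * a * b * b = 1 by rewrite a2b.
have b1 : b <= 1 by rewrite -[leRHS]expR0 ler_expR; lra.
have bh : 1 - b <= 2 * h by have := expR_ge1Dx (- (2 * h)); rewrite -/b; lra.
have hb : (1 - b) ^+ 2 <= (2 * h) ^+ 2 by rewrite ler_pXn2r // nnegrE; lra.
have : 0 <= (1 - b) ^+ 2 * ((a - 2) ^+ 2 + 1).
  by rewrite mulr_ge0 ?sqr_ge0 // addr_ge0 ?sqr_ge0.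
nra.
Qed.

Lemma sqr_expR_lower h :
  3 / 8 * (expR (2 * h) + expR (- (2 * h))) <=
  h ^+ 2 + (expR (4 * h) + expR (- (4 * h))) / 16 + 5 / 8.
Proof.
have [h0|h0] := leP 0 h; first exact: sqr_expR_lower_pos.
have := @sqr_expR_lower_pos (- h); rewrite oppr_ge0 ltW // => /(_ isT).
by rewrite !mulrN !opprK sqrrN; lra.
Qed.

Lemma expR_ge_id x : x <= expR x.
Proof. by have := expR_ge1Dx x; lra. Qed.

(** The left factor is a chi-square moment. It exceeds [(1 + gamma) ^ (k / 2)] by
    [(1 - x) ^ (- k / 2)], at most [expR (k * x)], and the surplus [delta * L] pays for [k * x]
    because [L] is at least [cgam gamma * k]. *)
Lemma chi2_mgf_penalty gamma delta L (k : nat) : 0 < gamma ->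
  0 < delta -> delta * (6 * (1 + gamma)) = 1 -> cgam gamma * k%:R <= L ->
  (Num.sqrt (1 - (1 + delta) ^+ 2 * gamma / (1 + gamma)))^-1 ^+ k *
    expR (- ((1 + delta) * (L + k%:R / 2 * ln (1 + gamma)))) <= expR (- L).
Proof.
move=> g0 d0 dE Lk.
have g1 : 0 < 1 + gamma by lra.
have d1 : delta <= 1 by nra.
set x := gamma * (2 * delta + delta ^+ 2).
have x0 : 0 <= x by rewrite /x; nra.
(* The factor 6 in [dE] is chosen for this: [x <= 3 * gamma * delta], which is
   [gamma / (2 * (1 + gamma))]. *)
have x2 : x <= 2^-1 by rewrite /x; nra.
have -> : 1 - (1 + delta) ^+ 2 * gamma / (1 + gamma) = (1 - x) / (1 + gamma).
  rewrite -[X in X - _](mulfV (lt0r_neq0 g1)) -mulrBl; congr (_ / _);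
    rewrite /x; lra.
have ex : expR (- (2 * x)) <= 1 - x.
  rewrite expRN -div1r ler_pdivrMr ?expR_gt0 //.
  have := expR_ge1Dx (2 * x); set E := expR _ => xE.
  apply: le_trans (_ : (1 - x) * (1 + 2 * x) <= _); first by nra.
  by rewrite ler_pM2l //; lra.
have bk : (Num.sqrt ((1 - x) / (1 + gamma)))^-1 <=
    expR (ln (1 + gamma) / 2 + x).
  rewrite -(@ler_pXn2r _ 2) ?nnegrE ?invr_ge0 ?expR_ge0 //.
  rewrite exprVn sqr_sqrtr ?divr_ge0; try lra.
  rewrite invf_div -expRM_natl mulrDr mulrCA mulfV ?mulr1 // expRD lnK ?posrE
    //.
  rewrite ler_pM2l // -[leRHS]invrK -expRN lef_pV2 ?posrE ?expR_gt0 //; lra.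
have : (Num.sqrt ((1 - x) / (1 + gamma)))^-1 ^+ k <=
    expR (k%:R * (ln (1 + gamma) / 2 + x)).
  by rewrite expRM_natl lerXn2r ?nnegrE ?invr_ge0 ?expR_ge0.
move=> /(ler_wpM2r (expR_ge0 _)) /le_trans; apply.
rewrite -expRD ler_expR.
have lg : 0 <= ln (1 + gamma) by rewrite ln_ge0 //; lra.
have k0 : 0 <= k%:R :> R by [].
have xL : k%:R * x <= delta * L.
  apply: le_trans (_ : delta * (cgam gamma * k%:R) <= _);
    last by rewrite ler_pM2l.
  rewrite [leRHS]mulrCA mulrC mulrA [cgam _ * _]mulrC; apply: ler_wpM2r => //.
  by rewrite /x /cgam; nra.
have : 0 <= delta * (k%:R / 2 * ln (1 + gamma)).
  apply: mulr_ge0; first exact: ltW.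
  by apply: mulr_ge0 => //; exact: divr_ge0.
lra.
Qed.

End RealInequalities.

(** * Sums over models grouped by size *)

Section SubsetSums.

Lemma sum_subsets_card (R : numDomainType) (p r : nat) (g : nat -> R) :
  \sum_(M : {set 'I_p} | (#|M| <= r)%N) g #|M| =
  \sum_(k < r.+1) 'C(p, k)%:R * g k.
Proof.
rewrite (partition_big (fun M : {set 'I_p} => inord #|M| : 'I_r.+1) predT) //=.
apply: eq_bigr => k _; rewrite -[p in 'C(p, _)]card_ord -card_draws -sum1_card.
rewrite natr_sum mulr_suml; apply: eq_big => M; last first.
  by move=> /andP[Mr /eqP <-]; rewrite inordK // mul1r.
rewrite inE; apply/andP/idP => [[Mr /eqP <-]|/eqP Mk]; first by rewrite inordK.
by rewrite Mk -ltnS ltn_ord; split => //; rewrite inord_val.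
Qed.

End SubsetSums.

(** * Moments of projected noise *)

Section RealIntegrals.
Context d (T : measurableType d) (R : realType) (P : probability T R).
Implicit Types (g h : T -> R).

Lemma ge0_integral_add g h (a b : R) :
  measurable_fun setT g -> measurable_fun setT h ->
  (forall w, 0 <= g w) -> (forall w, 0 <= h w) ->
  (\int[P]_w (g w)%:E = a%:E)%E -> (\int[P]_w (h w)%:E = b%:E)%E ->
  (\int[P]_w (g w + h w)%:E = (a + b)%:E)%E.
Proof.
move=> mg mh g0 h0 ga hb; under eq_integral do rewrite EFinD.
rewrite ge0_integralD ?ga ?hb //; try exact/measurable_EFinP.
- by move=> w _; rewrite lee_fin.
- by move=> w _; rewrite lee_fin.
Qed.

Lemma ge0_integral_scale g (a c : R) :
  measurable_fun setT g -> (forall w, 0 <= g w) -> 0 <= c ->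
  (\int[P]_w (g w)%:E = a%:E)%E -> (\int[P]_w (c * g w)%:E = (c * a)%:E)%E.
Proof.
move=> mg g0 c0 ga; under eq_integral do rewrite EFinM.
rewrite ge0_integralZl_EFin ?ga //; first by move=> w _; rewrite lee_fin.
exact/measurable_EFinP.
Qed.

Lemma integral_cst_prob (c : R) : (\int[P]_w c%:E = c%:E)%E.
Proof. by rewrite integral_cst //= probability_setT mule1. Qed.

End RealIntegrals.

Section NoiseMoments.
Context d (T : measurableType d) (R : realType) (P : probability T R).
Variables (n : nat) (sigma : R) (eps : 'I_n -> {RV P >-> R}).
Hypothesis sigma0 : 0 < sigma.
Hypothesis Heps : gaussian_noise sigma eps.

Let e (w : T) : 'cV[R]_n := \col_i eps i w.

Let mdot u : measurable_fun setT (fun w => dotv u (e w)).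
Proof. exact: measurable_dotv. Qed.

Lemma measurable_sqnorm_mulmx (H : 'M[R]_n) :
  measurable_fun setT (fun w => sqnorm (H *m e w)).
Proof.
apply: measurable_sum => i; apply: measurable_funX.
rewrite (_ : (fun w => _) = (fun w => dotv (row i H)^T (e w)));
  first exact: mdot.
by apply/funext => w; rewrite /dotv trmxK -row_mul [RHS]mxE.
Qed.

(* The law of [dotv u eps] is never identified: its second moment is bounded
   below through [sqr_expR_lower], which involves exponential moments only. *)
Lemma integral_dotv_sqr_ge (u : 'cV[R]_n) : sqnorm u = 1 ->
  ((sigma ^+ 2 / 4)%:E <= \int[P]_w (dotv u (e w) ^+ 2)%:E)%E.
Proof.
move=> u1; set J := (\int[P]_w _)%E.
have J0 : (0 <= J)%E by apply: integral_ge0 => w _; rewrite lee_fin sqr_ge0.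
(* With [lam ^+ 2 * sigma ^+ 2 = 2 * L], the exponential moments at [lam] and [2 * lam] are the
   rationals [11 / 10] and [(11 / 10) ^+ 4]. *)
pose L := ln (1 + 10%:R^-1 : R).
have L0 : 0 < L by rewrite ln_gt0 //; lra.
have L1 : L <= 10^-1 by apply: le_ln1Dx; lra.
pose lam := Num.sqrt (2 * L) / sigma.
have lam2 : lam ^+ 2 * sigma ^+ 2 = 2 * L.
  by rewrite -exprMn divfK ?gt_eqF // sqr_sqrtr // mulr_ge0 // ltW.
have lampos : 0 < lam by rewrite divr_gt0 // sqrtr_gt0 mulr_gt0.
have E1 (c : R) : c ^+ 2 = lam ^+ 2 ->
    (\int[P]_w (expR (dotv (c *: u) (e w)))%:E = (11 / 10)%:E)%E.
  move=> cl; rewrite (integral_exp_linear sigma0 Heps) sqnormZ u1 mulr1 cl.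
  have -> : sigma ^+ 2 * lam ^+ 2 / 2 = L by have := lam2; lra.
  by rewrite lnK ?posrE; [congr EFin; lra|lra].
have E2 (c : R) : c ^+ 2 = lam ^+ 2 ->
    (\int[P]_w (expR (dotv ((2 * c) *: u) (e w)))%:E = ((11 / 10) ^+ 4)%:E)%E.
  move=> cl; rewrite (integral_exp_linear sigma0 Heps) sqnormZ u1 mulr1 exprMn
    cl.
  have -> : sigma ^+ 2 * (2 ^+ 2 * lam ^+ 2) / 2 = 4 * L.
    by have := lam2; lra.
  rewrite -[4 * L]/(4%:R * L) expRM_natl lnK ?posrE; last by lra.
  by congr (_ ^+ _)%:E; lra.
have ml c : measurable_fun setT (fun w => expR (dotv (c *: u) (e w))).
  by apply: measurableT_comp => //; exact: mdot.
have : (\int[P]_w (3 / 8 * (expR (dotv (lam *: u) (e w)) +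
          expR (dotv (- lam *: u) (e w))))%:E <=
       \int[P]_w (lam ^+ 2 / 4 * dotv u (e w) ^+ 2 +
         (16^-1 * (expR (dotv ((2 * lam) *: u) (e w)) +
            expR (dotv ((2 * - lam) *: u) (e w))) + 5 / 8))%:E)%E.
  apply: ge0_le_integral => //.
  - by apply/measurable_EFinP; apply: measurable_funM => //;
      apply: measurable_funD.
  - apply/measurable_EFinP; apply: measurable_funD.
      by apply: measurable_funM => //; apply: measurable_funX.
    by apply: measurable_funD => //; apply: measurable_funM => //;
      apply: measurable_funD.
  - move=> w _; rewrite lee_fin !dotvZl.
    have := @sqr_expR_lower R (lam * dotv u (e w) / 2).
    have -> : 2 * (lam * dotv u (e w) / 2) = lam * dotv u (e w) by lra.
    have -> : 4 * (lam * dotv u (e w) / 2) = 2 * lam * dotv u (e w) by lra.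
    have -> : (lam * dotv u (e w) / 2) ^+ 2 = lam ^+ 2 / 4 * dotv u (e w) ^+ 2
      by lra.
    by rewrite mulrN !mulNr; lra.
rewrite [leLHS](_ : _ = (3 / 8 * (11 / 10 + 11 / 10))%:E); last first.
  apply: ge0_integral_scale => //; first exact: measurable_funD.
  apply: ge0_integral_add => //; try (by move=> w; exact: expR_ge0).
    exact: E1.
  by apply: E1; rewrite sqrrN.
rewrite [leRHS](_ : _ = ((lam ^+ 2 / 4)%:E * J +
    (16^-1 * ((11 / 10) ^+ 4 + (11 / 10) ^+ 4) + 5 / 8)%:E)%E); last first.
  under eq_integral do rewrite EFinD.
  rewrite ge0_integralD //; last 3 first.
  - by move=> w _; rewrite lee_fin mulr_ge0 ?sqr_ge0 // divr_ge0 ?sqr_ge0.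
  - by apply/measurable_EFinP; apply: measurable_funM => //;
      exact: measurable_funX.
  - by apply/measurable_EFinP; apply: measurable_funD => //;
      apply: measurable_funM => //; apply: measurable_funD.
  congr (_ + _)%E.
    under eq_integral do rewrite EFinM.
    rewrite ge0_integralZl_EFin //.
    - by move=> w _; rewrite lee_fin sqr_ge0.
    - by apply/measurable_EFinP; exact: measurable_funX.
    - by rewrite divr_ge0 ?sqr_ge0.
  have m2 : measurable_fun setT (fun w => expR (dotv ((2 * lam) *: u) (e w)) +
            expR (dotv ((2 * - lam) *: u) (e w))) by exact: measurable_funD.
  have p2 w : 0 <= expR (dotv ((2 * lam) *: u) (e w)) +
            expR (dotv ((2 * - lam) *: u) (e w)) by rewrite addr_ge0 ?expR_ge0.
  apply: ge0_integral_add => //.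
  - exact: measurable_funM.
  - apply: ge0_integral_scale => //.
    apply: ge0_integral_add => //; try (by move=> w; exact: expR_ge0).
      exact: E2.
    by apply: E2; rewrite sqrrN.
  - exact: integral_cst_prob.
have [->|JN] := eqVneq J +oo%E; first by rewrite leey.
have -> : J = (fine J)%:E by rewrite fineK // ge0_fin_numE // lt_neqAle JN leey.
rewrite -EFinM -EFinD !lee_fin => H.
have J0' : 0 <= fine J by exact: fine_ge0.
(* The goal becomes [L / 2 <= lam ^+ 2 * fine J]: the left side is at most 0.05, while [H] makes the
   right side at least 0.067. *)
rewrite -(ler_pM2l (_ : 0 < lam ^+ 2)) ?exprn_gt0 // mulrA lam2.
nra.
Qed.

(** The exact value is [sigma ^+ 2 * k]; the lost factor 4 only enlarges the final constant. *)
Lemma integral_proj_ge (H : 'M[R]_n) k : orthoproj H -> \tr H = k%:R ->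
  ((sigma ^+ 2 / 4 * k%:R)%:E <= \int[P]_w (sqnorm (H *m e w))%:E)%E.
Proof.
move=> pH tH; have [q oq HE] := orthoproj_basis pH tH.
under eq_integral do rewrite (sqnorm_basis _ pH HE) -sumEFin.
rewrite ge0_integral_sum //; last 2 first.
- by move=> i; apply/measurable_EFinP; exact: measurable_funX.
- by move=> i w _; rewrite lee_fin sqr_ge0.
rewrite (_ : _%:E = \sum_(i < k) (sigma ^+ 2 / 4)%:E)%E; last first.
  by rewrite sumEFin sumr_const card_ord mulr_natr.
apply: lee_sum => i _; apply: integral_dotv_sqr_ge.
by rewrite sqnorm_dotv oq ?ltn_ord // eqxx.
Qed.

Lemma integral_exp_proj (H : 'M[R]_n) k (v : 'cV[R]_n) (t : R) :
  orthoproj H -> \tr H = k%:R -> H *m v = 0 ->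
  0 <= t -> 2 * t * sigma ^+ 2 < 1 ->
  (\int[P]_w (expR (t * sqnorm (H *m e w) + dotv v (e w)))%:E =
   ((Num.sqrt (1 - 2 * t * sigma ^+ 2))^-1 ^+ k *
      expR (sigma ^+ 2 * sqnorm v / 2))%:E)%E.
Proof.
move=> pH tH Hv t0 t1; have [q oq HE] := orthoproj_basis pH tH.
under eq_integral do rewrite (sqnorm_basis _ pH HE).
apply: integral_exp_quadratic => // i ik.
have : sqnorm (H *m v) = 0 by rewrite Hv /sqnorm big1 // => j _;
  rewrite mxE expr0n.
rewrite (sqnorm_basis _ pH HE) => /eqP; rewrite psumr_eq0; last by move=> *;
  exact: sqr_ge0.
by move=> /allP /(_ (Ordinal ik) (mem_index_enum _));
  rewrite implyTb sqrf_eq0 => /eqP.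
Qed.

End NoiseMoments.

(** * The penalty *)

Lemma bin_leq_expn (m k : nat) : ('C(m, k) <= m ^ k)%N.
Proof.
apply: (@leq_trans (m ^_ k)); first by rewrite -bin_ffact leq_pmulr ?fact_gt0.
by elim: k => // k IH; rewrite ffactnSr expnSr leq_mul ?leq_subr.
Qed.

Section Penalty.
Variables (R : realType) (p r : nat) (sigma gamma c : R) (prior : nat -> R).
Hypothesis rp : (r <= p)%N.
Hypothesis gamma0 : 0 < gamma.
Hypothesis prior0 : forall k, (k <= r)%N -> 0 < prior k.

(** The part of the logarithm in [Pen] that comes from the prior and the number of models. *)
Definition level (k : nat) : R :=
  ln ((if (k < r)%N then 'C(p, k)%:R else 1) * (prior k)^-1).

(* The models of size [r] all have the same fit, so each counts for one of
   ['C(p, r)]. *)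
Definition weight (k : nat) : R := if (k < r)%N then 1 else ('C(p, k)%:R)^-1.

Let binp k : (k <= r)%N -> 0 < 'C(p, k)%:R :> R.
Proof. by move=> kr; rewrite ltr0n bin_gt0 (leq_trans kr). Qed.

Let arg_gt0 k : (k <= r)%N ->
  0 < (if (k < r)%N then 'C(p, k)%:R else 1) * (prior k)^-1 :> R.
Proof.
by move=> kr; rewrite mulr_gt0 ?invr_gt0 ?prior0 //; case: ifP => // _;
  exact: binp.
Qed.

Lemma PenE k : (k <= r)%N -> Pen p r sigma gamma prior k =
  2 * sigma ^+ 2 * (1 + gamma^-1) * (level k + k%:R / 2 * ln (1 + gamma)).
Proof.
move=> kr; have g1 : 0 < 1 + gamma by exact: addr_gt0.
by rewrite /Pen lnM ?posrE ?arg_gt0 ?powR_gt0 // ln_powR.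
Qed.

(** The weight removes the special case of size [r], so that summing over all models gives the total
    mass of the prior. *)
Lemma weight_level k : (k <= r)%N ->
  weight k * expR (- level k) = prior k / 'C(p, k)%:R.
Proof.
move=> kr; rewrite expRN lnK ?posrE ?arg_gt0 // invfM invrK /weight.
by case: ifP => _; rewrite ?invr1 mul1r // mulrC.
Qed.

Lemma weight_ge0 k : 0 <= weight k.
Proof. by rewrite /weight; case: ifP. Qed.

Hypothesis prior_ub : forall k, (k < r)%N ->
  prior k <= 'C(p, k)%:R * expR (- (cgam gamma * k%:R)).
Hypothesis prior_r : prior r <= expR (- (cgam gamma * r%:R)).

(** The upper bounds on the prior enter the argument through this inequality alone. *)
Lemma level_ge k : (k <= r)%N -> cgam gamma * k%:R <= level k.
Proof.
move=> kr; rewrite -[leLHS]expRK ler_ln ?posrE ?expR_gt0 ?arg_gt0 //.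
rewrite ler_pdivlMr ?prior0 // mulrC -ler_pdivlMr ?expR_gt0 // -expRN.
by case: ltnP => kr'; [exact: prior_ub|rewrite mul1r (_ : k = r) //;
  apply/eqP; rewrite eqn_leq kr].
Qed.

Lemma Pen_ge0 k : (k <= r)%N -> 0 <= Pen p r sigma gamma prior k.
Proof.
move=> kr; rewrite PenE //; apply: mulr_ge0.
  by rewrite mulr_ge0 //;
    [exact/mulr_ge0/sqr_ge0|rewrite addr_ge0 // invr_ge0 ltW].
apply: addr_ge0; last by rewrite mulr_ge0 ?divr_ge0 // ln_ge0 // lerDl ltW.
by apply: le_trans (level_ge kr); rewrite mulr_ge0 // /cgam mulr_ge0 // sqr_ge0.
Qed.

Hypothesis prior_lb0 : p%:R `^ (- c) <= prior 0%N.
Hypothesis prior_lb : forall k, (1 <= k <= r)%N -> p%:R `^ (- (c * k%:R)) <=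
  prior k.
Hypothesis c0 : 0 < c.
Hypothesis p2 : (2 <= p)%N.

Lemma lnp_ge : 2^-1 <= ln p%:R :> R.
Proof.
apply: le_trans (ln2_ge_half R) _.
by rewrite ler_ln ?posrE ?ltr0n ?ler_nat // (leq_trans _ p2).
Qed.

(** The binomial is at most [p ^ k], and the prior at least [p] to the power [- c * k.+1]; the
    successor covers size 0, where the lower bound is [p] to the power [- c]. *)
Lemma level_le k : (k <= r)%N -> level k <= (1 + c) * k.+1%:R * ln p%:R.
Proof.
move=> kr; have lp := lnp_ge;
  have p0 : 0 < p%:R :> R by rewrite ltr0n (leq_trans _ p2).
rewrite /level lnM ?posrE ?invr_gt0 ?prior0 //; last by case: ifP => // _;
  exact: binp.
rewrite lnV ?posrE ?prior0 //.
have k0 : 0 <= k%:R :> R by [].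
have l1 : ln (if (k < r)%N then 'C(p, k)%:R else 1) <= k%:R * ln p%:R :> R.
  case: ifP => _; last by rewrite ln1 mulr_ge0 //; lra.
  rewrite mulr_natl -lnXn // ler_ln ?posrE ?exprn_gt0 ?binp // -natrX ler_nat.
  exact: bin_leq_expn.
have l2 : - (c * k.+1%:R * ln p%:R) <= ln (prior k).
  have lb (q x : R) : 0 < x -> p%:R `^ (- q) <= x -> - (q * ln p%:R) <= ln x.
    by move=> x0 qx; rewrite -mulNr -ln_powR ler_ln ?posrE ?powR_gt0.
  case: k kr {k0 l1} => [|k] kr; first by rewrite mulr1; apply: lb => //;
    exact: prior0.
  apply: le_trans (lb (c * k.+1%:R) _ (prior0 kr) (prior_lb _)) => //.
  rewrite lerN2 ler_wpM2r //; first by lra.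
  by rewrite ler_wpM2l ?ler_nat // ltW.
have -> : k.+1%:R = 1 + k%:R :> R by rewrite mulrS.
move: l2; rewrite mulrS; nra.
Qed.

Lemma Pen_le k : (k <= r)%N -> Pen p r sigma gamma prior k <=
  2 * (1 + gamma^-1) * (1 + c + gamma) * sigma ^+ 2 * k.+1%:R * ln p%:R.
Proof.
move=> kr; rewrite PenE //; have lp := lnp_ge; have := level_le kr => Lk.
have g0 : 0 <= gamma^-1 by rewrite invr_ge0 ltW.
have lg : ln (1 + gamma) <= gamma by apply: le_ln1Dx;
  rewrite (lt_trans _ gamma0) ?ltrN10.
have -> : 2 * (1 + gamma^-1) * (1 + c + gamma) * sigma ^+ 2 * k.+1%:R * ln
  p%:R =
  2 * sigma ^+ 2 * (1 + gamma^-1) * ((1 + c) * k.+1%:R * ln p%:R + gamma *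
    k.+1%:R * ln p%:R) by lra.
apply: ler_wpM2l; first by rewrite mulr_ge0 //;
  [exact/mulr_ge0/sqr_ge0|rewrite addr_ge0].
apply: lerD => //; apply: le_trans (_ : k%:R / 2 * gamma <= _).
  by rewrite ler_wpM2l // divr_ge0.
rewrite mulrC -!mulrA; apply: ler_wpM2l; first exact: ltW.
by apply: ler_pM => //; rewrite ?ler_nat //; lra.
Qed.

End Penalty.

(** * Risk of the MAP selector *)

Section MAPRisk.
Context d (T : measurableType d) (R : realType) (P : probability T R).
Variables (n p r : nat) (X : 'M[R]_(n, p)) (beta : 'cV[R]_p) (sigma gamma : R).
Variables (eps : 'I_n -> {RV P >-> R}) (prior : nat -> R).
Variable Mhat : 'cV[R]_n -> {set 'I_p}.
Hypothesis rX : \rank X = r.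
Hypothesis Xr : columns_free X r.
Hypothesis sigma0 : 0 < sigma.
Hypothesis gamma0 : 0 < gamma.
Hypothesis Heps : gaussian_noise sigma eps.

Let e (w : T) : 'cV[R]_n := \col_i eps i w.

Definition bias M : 'cV[R]_n := (1%:M - fit X M) *m (X *m beta).

Definition loss M w : R :=
  sqnorm (X *m lse X M (response X beta eps w) - X *m beta).

Lemma loss_split M w :
  loss M w = sqnorm (bias M) + sqnorm (fit X M *m e w).
Proof.
by rewrite /loss mulmx_lse /response -/(e w) (orthoproj_loss _ _
  (orthoproj_fit X M)).
Qed.

Lemma measurable_loss M : measurable_fun setT (loss M).
Proof.
rewrite (_ : loss M = fun w => sqnorm (bias M) + sqnorm (fit X M *m e w)).
  by apply: measurable_funD => //; exact: measurable_sqnorm_mulmx.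
by apply/funext => w; exact: loss_split.
Qed.

Let rp : (r <= p)%N. Proof. by rewrite -rX rank_leq_col. Qed.

Let tr_fit (M : {set 'I_p}) : (#|M| <= r)%N -> \tr (fit X M) = #|M|%:R.
Proof. by move=> Mr; apply: mxtrace_fit; apply: columns_free_inj Xr _;
  rewrite Mr. Qed.

Lemma expected_loss_ge (M : {set 'I_p}) : (#|M| <= r)%N ->
  ((sqnorm (bias M) + sigma ^+ 2 / 4 * #|M|%:R)%:E <= \int[P]_w (loss M
    w)%:E)%E.
Proof.
move=> Mr; under eq_integral do rewrite loss_split EFinD.
rewrite ge0_integralD //; last 3 first.
- by move=> w _; rewrite lee_fin sqnorm_ge0.
- by move=> w _; rewrite lee_fin sqnorm_ge0.
- by apply/measurable_EFinP; exact: measurable_sqnorm_mulmx.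
rewrite integral_cst_prob EFinD leeD2l //.
exact: (integral_proj_ge sigma0 Heps (orthoproj_fit X M) (tr_fit Mr)).
Qed.

Variables (delta s0 : R).
Hypothesis delta0 : 0 < delta.
Hypothesis deltaE : delta * (6 * (1 + gamma)) = 1.
Hypothesis s0E : s0 = (1 + delta) * gamma / (2 * (1 + gamma)).

(* [s] is chosen so that [s * pen M] is [1 + delta] times
   [level |M| + |M| / 2 * ln (1 + gamma)]. *)
Let s : R := s0 / sigma ^+ 2.

Let delta1 : delta <= 6^-1.
Proof. have := deltaE; have := delta0; have := gamma0; nra. Qed.

Let s0_gt0 : 0 < s0.
Proof.
rewrite s0E divr_gt0 ?mulr_gt0 ?addr_gt0 //.
Qed.

Let s_gt0 : 0 < s.
Proof. by rewrite divr_gt0 ?exprn_gt0. Qed.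

Let s_sigma : s * sigma ^+ 2 = s0.
Proof. by rewrite /s divfK // sqrf_eq0 gt_eqF. Qed.

Let s0_gamma : 2 * s0 * (1 + gamma) = (1 + delta) * gamma.
Proof.
have g1 : 2 * (1 + gamma) != 0 by rewrite mulf_neq0 // lt0r_neq0 // addr_gt0.
by rewrite -[2 * s0]mulrC -mulrA s0E divfK.
Qed.

Hypothesis prior0 : forall k, (k <= r)%N -> 0 < prior k.
Hypothesis prior1 : \sum_(k < r.+1) prior k = 1.
Hypothesis prior_ub : forall k, (k < r)%N ->
  prior k <= 'C(p, k)%:R * expR (- (cgam gamma * k%:R)).
Hypothesis prior_r : prior r <= expR (- (cgam gamma * r%:R)).

Local Notation pen M := (Pen p r sigma gamma prior #|M|).

(** Chosen so that [delta * loss M w - excess M w] is the MAP criterion of [M] less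
    [sqnorm (e w)]. *)
Definition excess M w : R :=
  (1 + delta) * sqnorm (fit X M *m e w) - 2 * dotv (bias M) (e w)
  - (1 - delta) * sqnorm (bias M) - pen M.

Lemma measurable_excess M : measurable_fun setT (excess M).
Proof.
apply: measurable_funB => //; apply: measurable_funB => //;
  apply: measurable_funB.
  by apply: measurable_funM => //; exact: measurable_sqnorm_mulmx.
by apply: measurable_funM => //; exact: measurable_dotv.
Qed.

(** The bias is orthogonal to the range of the fit, so the moment splits into a chi-square factor,
    absorbed by the penalty, and a Gaussian factor from the cross term, absorbed by the negative
    bias term. *)
Lemma integral_exp_excess (M : {set 'I_p}) : (#|M| <= r)%N ->
  (\int[P]_w (expR (s * excess M w))%:E <= (expR (- level p r prior
    #|M|))%:E)%E.
Proof.
move=> Mr; have pH := orthoproj_fit X M.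
set t := s * (1 + delta); set v := (- (2 * s)) *: bias M.
set C := expR (- (s * (1 - delta) * sqnorm (bias M) + s * pen M)).
have Hv : fit X M *m v = 0.
  by rewrite /v -scalemxAr /bias (mulmxA (fit X M)) mulmxBr mulmx1 (proj2 pH)
    subrr mul0mx scaler0.
have tE : 2 * t * sigma ^+ 2 = (1 + delta) ^+ 2 * gamma / (1 + gamma).
  apply: (mulIf (lt0r_neq0 (addr_gt0 (@ltr01 R) gamma0))).
  rewrite divfK ?lt0r_neq0 ?addr_gt0 //.
  have -> : 2 * t * sigma ^+ 2 = 2 * (s * sigma ^+ 2) * (1 + delta) by rewrite
    /t; lra.
  rewrite s_sigma.
  have -> : 2 * s0 * (1 + delta) * (1 + gamma) = 2 * s0 * (1 + gamma) * (1 +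
    delta) by lra.
  by rewrite s0_gamma; lra.
have t1 : 2 * t * sigma ^+ 2 < 1.
  rewrite tE ltr_pdivrMr ?addr_gt0 // mul1r.
  by have := deltaE; have := delta0; have := delta1; have := gamma0; nra.
have t0 : 0 <= t by rewrite mulr_ge0 ?ltW // addr_gt0.
under eq_integral => w _.
  have -> : expR (s * excess M w) =
      C * expR (t * sqnorm (fit X M *m e w) + dotv v (e w)).
    rewrite -expRD /v dotvZl /excess /t; congr expR; lra.
  over.
rewrite (@ge0_integral_scale _ _ _ _ _ _ _ _ _ _
  (integral_exp_proj sigma0 Heps pH (tr_fit Mr) Hv t0 t1)) //; last 2 first.
- apply: measurableT_comp => //; apply: measurable_funD.
    by apply: measurable_funM => //; exact: measurable_sqnorm_mulmx.
  exact: measurable_dotv.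
- exact: expR_ge0.
rewrite lee_fin tE.
apply: le_trans (chi2_mgf_penalty gamma0 delta0 deltaE
  (level_ge rp prior0 prior_ub prior_r Mr)).
rewrite mulrCA ler_wpM2l ?exprn_ge0 ?invr_ge0 // /C -expRD ler_expR.
have -> : s * pen M = (1 + delta) * (level p r prior #|M| + #|M|%:R / 2 * ln
  (1 + gamma)).
  rewrite (PenE sigma rp gamma0 prior0 Mr) mulrA; congr (_ * _).
  apply: (mulIf (lt0r_neq0 gamma0)).
  have -> : s * (2 * sigma ^+ 2 * (1 + gamma^-1)) * gamma =
    2 * (s * sigma ^+ 2) * (gamma + gamma^-1 * gamma) by lra.
  by rewrite s_sigma mulVf ?lt0r_neq0 // -s0_gamma addrC.
have a0 := sqnorm_ge0 (bias M).
(* The cross term adds [2 * s0 * s * sqnorm (bias M)] to the exponent, against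
   [(1 - delta) * s * sqnorm (bias M)] subtracted in [C]. The inequality amounts to
   [delta * (1 + 2 * gamma) <= 1]. *)
suff : 2 * s0 <= 1 - delta.
  rewrite /v sqnormZ => h.
  have -> : sigma ^+ 2 * ((- (2 * s)) ^+ 2 * sqnorm (bias M)) / 2 =
    s * sqnorm (bias M) * (2 * (s * sigma ^+ 2)) by lra.
  rewrite s_sigma; set q := s * sqnorm (bias M).
  have q0 : 0 <= q by rewrite mulr_ge0 // ltW.
  have -> : s * (1 - delta) * sqnorm (bias M) = q * (1 - delta) by rewrite /q;
    lra.
  by have := ler_wpM2l q0 h; lra.
have := s0_gamma; have := deltaE; have := delta0; have := delta1;
  have := gamma0; nra.
Qed.

Lemma weighted_exp_sum_le :
  (\int[P]_w (\sum_(M : {set 'I_p} | (#|M| <= r)%N)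
      weight R p r #|M| * expR (s * excess M w))%:E <= 1%:E)%E.
Proof.
under eq_integral do rewrite -sumEFin -big_filter.
have mE M : measurable_fun setT (fun w => expR (s * excess M w)).
  by apply: measurableT_comp => //; apply: measurable_funM => //;
    exact: measurable_excess.
have w0 := weight_ge0 R p r.
rewrite ge0_integral_sum //; last 2 first.
- by move=> M; apply/measurable_EFinP; exact: measurable_funM.
- by move=> M w _; rewrite lee_fin mulr_ge0 ?expR_ge0.
rewrite big_filter.
apply: (@le_trans _ _ (\sum_(M : {set 'I_p} | (#|M| <= r)%N)
  (weight R p r #|M| * expR (- level p r prior #|M|))%:E)%E).
  apply: lee_sum => M Mr; under eq_integral do rewrite EFinM.
  rewrite ge0_integralZl_EFin //; last exact/measurable_EFinP.
  by rewrite EFinM lee_wpmul2l ?lee_fin // integral_exp_excess.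
rewrite sumEFin lee_fin -prior1.
under eq_bigr => M Mr do rewrite (weight_level rp prior0 Mr).
rewrite (sum_subsets_card p r (fun k => prior k / 'C(p, k)%:R)).
apply: ler_sum => k _; rewrite mulrC divfK // pnatr_eq0 -lt0n bin_gt0.
by rewrite (leq_trans _ rp) // -ltnS.
Qed.

Hypothesis MAP : MAP_selector X r sigma gamma prior Mhat.

Lemma MAP_loss_le (M : {set 'I_p}) w : (#|M| <= r)%N ->
  delta * loss (Mhat (response X beta eps w)) w <=
  sqnorm (bias M) + pen M + 2 * dotv (bias M) (e w) +
  excess (Mhat (response X beta eps w)) w.
Proof.
move=> Mr; set y := response X beta eps w; set M' := Mhat y.
have [M'r /(_ M Mr)] := MAP y; rewrite -/M' /MAP_criterion !mulmx_lse.
rewrite !(orthoproj_residual _ _ (orthoproj_fit X _)) -!/(bias _) -/(e w)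
  loss_split /excess.
(* The projected noise of the competitor [M] enters with a minus sign and is dropped. *)
have := sqnorm_ge0 (fit X M *m e w).
by lra.
Qed.

(** Since [x <= expR x], the excess of the random model is bounded by a sum over all models, which
    no longer involves the selection. At size [r] the weight is [1 / 'C(p, r)], and the full term is
    recovered from the ['C(p, r)] models of that size, whose excesses coincide. *)
Lemma excess_le_sum w (y := response X beta eps w) :
  excess (Mhat y) w <=
  s^-1 * \sum_(M : {set 'I_p} | (#|M| <= r)%N)
      weight R p r #|M| * expR (s * excess M w).
Proof.
have [M'r _] := MAP y; set M' := Mhat y in M'r *.
rewrite ler_pdivlMl //; apply: le_trans (expR_ge_id _) _.
have t0 (M : {set 'I_p}) : 0 <= weight R p r #|M| * expR (s * excess M w).
  by rewrite mulr_ge0 ?weight_ge0 ?expR_ge0.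
have [lt|ge] := ltnP #|M'| r.
  rewrite (bigD1 M') //= /weight lt mul1r lerDl.
  by apply: sumr_ge0 => M _; exact: t0.
have cM' : #|M'| = r by apply/eqP; rewrite eqn_leq ge M'r.
apply: (@le_trans _ _ (\sum_(M : {set 'I_p} | #|M| == r)
  weight R p r #|M| * expR (s * excess M w))); last first.
  rewrite [leRHS](bigID (fun M : {set 'I_p} => #|M| == r)) /=.
  rewrite [X in _ <= X + _](eq_bigl (fun M : {set 'I_p} => #|M| == r)).
    by rewrite lerDl; apply: sumr_ge0 => M _; exact: t0.
  by move=> M /=; rewrite andb_idl // => /eqP ->.
rewrite (eq_bigr (fun=> ('C(p, r)%:R)^-1 * expR (s * excess M' w))).
  rewrite sumr_const -cardsE card_draws card_ord -[leRHS]mulr_natl mulrA mulfV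
    ?mul1r //.
  by rewrite pnatr_eq0 -lt0n bin_gt0.
move=> M /eqP cM; rewrite /weight cM ltnn; congr (_ * expR (_ * _)).
rewrite /excess /bias cM cM'.
by rewrite (fit_saturated rX Xr cM) (fit_saturated rX Xr cM').
Qed.

Hypothesis mMhat : forall M : {set 'I_p},
  measurable [set w | Mhat (response X beta eps w) = M].

Lemma measurable_MAP_loss :
  measurable_fun setT (fun w => loss (Mhat (response X beta eps w)) w).
Proof.
rewrite (_ : (fun w => _) = (fun w => \sum_(M : {set 'I_p})
    \1_[set w | Mhat (response X beta eps w) = M] w * loss M w)).
  apply: measurable_sum => M; apply: measurable_funM;
    last exact: measurable_loss.
  exact: measurable_indic.
apply/funext => w; rewrite (bigD1 (Mhat (response X beta eps w))) //= big1.
  by rewrite indicE mem_set //= mul1r addr0.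
move=> M MM; rewrite indicE memNset ?mul0r //= => E.
by move: MM; rewrite E eqxx.
Qed.

(* When [bias M = 0] the inverse is [0^-1 = 0] and both sides are still
   comparable. *)
Lemma cross_term_le M w : 2 * dotv (bias M) (e w) <=
  (sqnorm (bias M) + sigma ^+ 2) *
  expR (dotv ((Num.sqrt (sqnorm (bias M)) * sigma)^-1 *: bias M) (e w)).
Proof.
set v := bias M; set q := Num.sqrt (sqnorm v) * sigma.
have v0 := sqnorm_ge0 v.
have [vE|vN] := eqVneq (sqnorm v) 0.
  rewrite (sqnorm_eq0 vE) dot0v mulr0 mulr_ge0 ?expR_ge0 // addr_ge0 ?sqr_ge0
    //.
  exact: sqnorm_ge0.
have q0 : 0 < q by rewrite mulr_gt0 // sqrtr_gt0 lt_neqAle eq_sym vN.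
rewrite dotvZl; set z := q^-1 * _.
have -> : dotv v (e w) = q * z by rewrite /z mulVKf ?gt_eqF.
(* The factor is then bounded by [2 * q <= sqnorm v + sigma ^+ 2], where [q] is the product of the
   two square roots. *)
apply: (@le_trans _ _ (2 * q * expR z)).
  by rewrite -mulrA !ler_pM2l // expR_ge_id.
rewrite ler_wpM2r ?expR_ge0 // -[X in X + _](sqr_sqrtr v0) /q.
by have := sqr_ge0 (Num.sqrt (sqnorm v) - sigma); nra.
Qed.

(** For a nonzero bias the scaled linear form is standard normal, with exponential moment
    [expR 2^-1]. This bound replaces the zero mean of the cross term, so that every integrand stays
    nonnegative. *)
Lemma integral_cross_term M :
  (\int[P]_w (expR (dotv ((Num.sqrt (sqnorm (bias M)) * sigma)^-1 *: bias M)
     (e w)))%:E <= 2%:E)%E.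
Proof.
rewrite (integral_exp_linear sigma0 Heps) lee_fin sqnormZ exprVn exprMn.
rewrite sqr_sqrtr ?sqnorm_ge0 //.
have [->|vN] := eqVneq (sqnorm (bias M)) 0.
  by rewrite mul0r invr0 mul0r mulr0 mul0r expR0; lra.
apply: le_trans (expR_half_le2 R); rewrite ler_expR invfM.
set a := sqnorm _ in vN *; set b := sigma ^+ 2.
have b0 : b != 0 by rewrite sqrf_eq0 gt_eqF.
have -> : b * (a^-1 * b^-1 * a) / 2 = (a * a^-1) * (b * b^-1) / 2 by lra.
by rewrite !mulfV // !mul1r.
Qed.

(** The cross term contributes [2 * (sqnorm (bias M) + sigma ^+ 2)] and the excess [s^-1]. *)
Lemma MAP_risk_le (M : {set 'I_p}) : (#|M| <= r)%N ->
  (delta%:E * \int[P]_w (loss (Mhat (response X beta eps w)) w)%:E <=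
   (3 * sqnorm (bias M) + 2 * sigma ^+ 2 + pen M + s^-1)%:E)%E.
Proof.
move=> Mr; have a0 := sqnorm_ge0 (bias M).
have pen0 : 0 <= pen M by exact: (Pen_ge0 sigma rp gamma0 prior0 prior_ub
  prior_r).
set a := sqnorm (bias M) in a0 *.
pose G w := expR (dotv ((Num.sqrt (sqnorm (bias M)) * sigma)^-1 *: bias M) (e
  w)).
pose S w := \sum_(M : {set 'I_p} | (#|M| <= r)%N)
  weight R p r #|M| * expR (s * excess M w).
have S0 w : 0 <= S w.
  by apply: sumr_ge0 => ? _; rewrite mulr_ge0 ?weight_ge0 ?expR_ge0.
have mG : measurable_fun setT G.
  by apply: measurableT_comp => //; exact: measurable_dotv.
have mS : measurable_fun setT S.
  rewrite /S; under eq_fun do rewrite -big_filter.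
  apply: measurable_sum => M'; apply: measurable_funM => //;
    apply: measurableT_comp => //.
  by apply: measurable_funM => //; exact: measurable_excess.
have l0 w : 0 <= loss (Mhat (response X beta eps w)) w by exact: sqnorm_ge0.
rewrite -ge0_integralZl_EFin //; [|by move=> w _; rewrite lee_fin|
  exact/measurable_EFinP/measurable_MAP_loss|exact: ltW].
apply: (@le_trans _ _ (\int[P]_w ((a + pen M)%:E +
   ((a + sigma ^+ 2)%:E * (G w)%:E + s^-1%:E * (S w)%:E)))%E).
  apply: ge0_le_integral => //.
  - by move=> w _; rewrite -EFinM lee_fin mulr_ge0 // ltW.
  - apply/measurable_EFinP; apply: measurable_funM => //;
      exact: measurable_MAP_loss.
  - apply/measurable_EFinP; apply: measurable_funD => //;
      apply: measurable_funD;
      exact: measurable_funM.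
  move=> w _; rewrite -!EFinM -!EFinD lee_fin.
  apply: le_trans (MAP_loss_le w Mr) _; rewrite -addrA lerD2l.
  by apply: lerD; [exact: cross_term_le|exact: excess_le_sum].
have as0 : 0 <= a + sigma ^+ 2 by rewrite addr_ge0 // sqr_ge0.
have si0 : 0 <= s^-1 by rewrite invr_ge0 ltW.
rewrite ge0_integralD //; last 3 first.
- by move=> w _; rewrite lee_fin addr_ge0.
- by move=> w _; rewrite -!EFinM -EFinD lee_fin addr_ge0 // mulr_ge0 ?expR_ge0.
- by apply/measurable_EFinP; apply: measurable_funD; exact: measurable_funM.
rewrite ge0_integralD //; last 4 first.
- by move=> w _; rewrite -EFinM lee_fin mulr_ge0 ?expR_ge0.
- by apply/measurable_EFinP; exact: measurable_funM.
- by move=> w _; rewrite -EFinM lee_fin mulr_ge0.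
- by apply/measurable_EFinP; exact: measurable_funM.
rewrite !ge0_integralZl_EFin //; try exact/measurable_EFinP;
  try (by move=> w _; rewrite lee_fin ?expR_ge0).
rewrite integral_cst_prob.
have -> : 3 * a + 2 * sigma ^+ 2 + pen M + s^-1 =
  a + pen M + ((a + sigma ^+ 2) * 2 + s^-1 * 1) by lra.
rewrite [leRHS]EFinD leeD2l // [leRHS]EFinD leeD //;
  rewrite [leRHS]EFinM lee_wpmul2l ?lee_fin //.
  exact: integral_cross_term.
exact: weighted_exp_sum_le.
Qed.

End MAPRisk.

(** * The oracle inequality *)

Theorem theorem2 (R : realType) (gamma c : R) (gamma_gt0 : 0 < gamma)
    (c_gt0 : 0 < c) :
  exists2 c2 : R, 1 <= c2 &
  forall (d : measure_display) (T : measurableType d) (P : probability T R)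
    (n p r : nat) (X : 'M[R]_(n, p)) (beta : 'cV[R]_p) (sigma : R)
    (eps : 'I_n -> {RV P >-> R}) (prior : nat -> R)
    (Mhat : 'cV[R]_n -> {set 'I_p}),
  \rank X = r ->
  columns_free X r ->
  0 < sigma ->
  gaussian_noise sigma eps ->
  positive_pmf r prior ->
  (forall k, (k < r)%N ->
     prior k <= 'C(p, k)%:R * expR (- (cgam gamma * k%:R))) ->
  prior r <= expR (- (cgam gamma * r%:R)) ->
  p%:R `^ (- c) <= prior 0%N ->
  (forall k, (1 <= k <= r)%N -> p%:R `^ (- (c * k%:R)) <= prior k) ->
  MAP_selector X r sigma gamma prior Mhat ->
  (forall M : {set 'I_p},
     measurable [set w | Mhat (response X beta eps w) = M]) ->
  ('E_P[fun w => let y := response X beta eps w in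
          sqnorm (X *m lse X (Mhat y) y - X *m beta)]
   <= (c2 * ln p%:R)%:E *
      (ereal_inf [set 'E_P[fun w =>
           sqnorm (X *m lse X M (response X beta eps w) - X *m beta)]
         | M in @models p r] + (sigma ^+ 2)%:E))%E.
Proof.
pose delta : R := (6 * (1 + gamma))^-1.
pose s0 : R := (1 + delta) * gamma / (2 * (1 + gamma)).
pose K : R := 2 * (1 + gamma^-1) * (1 + c + gamma).
have g1 : 0 < 1 + gamma by exact: addr_gt0.
have deltaE : delta * (6 * (1 + gamma)) = 1 by rewrite mulVf // lt0r_neq0 //
  mulr_gt0.
have delta0 : 0 < delta by rewrite invr_gt0 mulr_gt0.
have delta1 : delta <= 1 by nra.
have s00 : 0 < s0 by rewrite divr_gt0 ?mulr_gt0 ?addr_gt0.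
have K0 : 0 < K by rewrite !mulr_gt0 ?addr_gt0 ?invr_gt0.
have si0 : 0 < s0^-1 by rewrite invr_gt0.
(* The 4 compensates the [1 / 4] of [expected_loss_ge], [K] comes from [Pen_le], and 6 and [2 / s0]
   are twice the 3 and [1 / s0] of [MAP_risk_le], as [1 <= 2 * ln p]. *)
exists (4 * (6 + K + 2 / s0) / delta).
  by rewrite ler_pdivlMr // mul1r; lra.
move=> d T P n p r X beta sigma eps prior Mhat rX Xr sigma0 Heps [prior0 prior1]
  prior_ub prior_r prior_lb0 prior_lb MAP mMhat.
rewrite -[in X in (_ <= X)%E]/(@loss _ _ _ _ _ _ X beta eps).
set S := [set _ | _ in _]; set C := _ * ln _.
have S0 x : S x -> (0 <= x)%E.
  by move=> [M _ <-]; rewrite unlock; apply: integral_ge0 => w _;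
    rewrite lee_fin sqnorm_ge0.
have inf0 : (0 <= ereal_inf S)%E by exact/ereal_infP.
have rp : (r <= p)%N by rewrite -rX rank_leq_col.
have C0 : 0 <= C.
  rewrite mulr_ge0 ?divr_ge0 ?mulr_ge0 ?(ltW delta0) //; first by lra.
  (* Here [p] may still be 0, where [ln 0] takes the default value 0. *)
  by case: (p) => [|p']; [rewrite ln0|rewrite ln_ge0 // ler1n].
(* With [r = 0] the matrix [X] vanishes and so does the loss; this case is separate because [ln p]
   may be 0. *)
have [r0|r0] := posnP r.
  rewrite [leLHS](_ : _ = 0%E); last first.
    rewrite unlock; apply: integral0_eq => w _ /=.
    have -> : X = 0 by apply/eqP; rewrite -mxrank_eq0 rX r0.
    by rewrite !mul0mx subrr /sqnorm big1 // => i _; rewrite mxE expr0n.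
  by apply: mule_ge0; rewrite ?lee_fin // adde_ge0 // lee_fin sqr_ge0.
(* If [p = r = 1] the lower bounds give the prior a mass of at least [2]. *)
have p2 : (2 <= p)%N.
  rewrite leqNgt ltnS; apply/negP => p1.
  have pE : p = 1%N by apply/eqP; rewrite eqn_leq p1 (leq_trans r0 rp).
  have rE : r = 1%N by apply/eqP; rewrite eqn_leq r0 -{1}pE rp.
  move: prior1; rewrite rE !big_ord_recr big_ord0 /= add0r => E.
  have := prior_lb 1%N; have := prior_lb0;
    rewrite rE pE !powR1 => h1 /(_ isT) h2.
  lra.
have lp := lnp_ge R p2.
have C1 : 0 < C.
  by rewrite mulr_gt0 ?divr_gt0 ?mulr_gt0 //; lra.
have bound (M : {set 'I_p}) : (#|M| <= r)%N ->
    (\int[P]_w (loss X beta eps (Mhat (response X beta eps w)) w)%:E <=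
     (C * (sqnorm (bias X beta M) + sigma ^+ 2 / 4 * #|M|%:R + sigma ^+
       2))%:E)%E.
  move=> Mr; rewrite -(lee_pmul2l (_ : delta%:E \is a fin_num)) ?lte_fin //.
  apply: le_trans (MAP_risk_le rX Xr sigma0 gamma_gt0 Heps delta0 deltaE
    (erefl s0) prior0 prior1 prior_ub prior_r MAP mMhat Mr) _.
  rewrite -EFinM lee_fin.
  have := @Pen_le R p r sigma gamma c prior rp gamma_gt0 prior0 prior_lb0
    prior_lb c_gt0 p2 _ Mr.
  rewrite -/K invf_div; set a := sqnorm _; set pen := Pen _ _ _ _ _ _ => penK.
  have a0 : 0 <= a by exact: sqnorm_ge0.
  have -> : delta * (C * (a + sigma ^+ 2 / 4 * #|M|%:R + sigma ^+ 2)) =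
    (delta^-1 * delta) * (4 * (6 + K + 2 / s0) * ln p%:R *
       (a + sigma ^+ 2 / 4 * #|M|%:R + sigma ^+ 2)) by rewrite /C; lra.
  rewrite mulVf ?gt_eqF // mul1r.
  set l := ln _ in lp penK *; set k := #|M|%:R.
  have kE : #|M|.+1%:R = 1 + k by rewrite mulrS.
  rewrite kE in penK.
  have k0 : 0 <= k by [].
  have q0 : 0 <= sigma ^+ 2 by exact: sqr_ge0.
  have V0 : 0 <= sigma ^+ 2 * (1 + k) by rewrite mulr_ge0 // addr_ge0.
  have l0 : 0 <= l by apply: le_trans lp; rewrite invr_ge0.
  set q := sigma ^+ 2 in q0 V0 penK *; set u := s0^-1 in si0 *.
  apply: (@le_trans _ _ ((6 + K + 2 * u) * l * (a + q * (1 + k)))); last first.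
    have -> : 4 * (6 + K + 2 * u) * l * (a + q / 4 * k + q) =
      (6 + K + 2 * u) * l * (4 * a + q * k + 4 * q) by lra.
    apply: ler_wpM2l; last by lra.
    by apply: mulr_ge0 => //; have := K0; have := si0; lra.
  have h1 : 2^-1 * (a + q * (1 + k)) <= l * (a + q * (1 + k)).
    by apply: ler_wpM2r => //; rewrite addr_ge0.
  have h2 : u * (2^-1 * (a + q * (1 + k))) <= u * (l * (a + q * (1 + k))).
    by apply: ler_wpM2l => //; exact: ltW.
  have h3 : 0 <= K * (l * a) by apply: mulr_ge0; [exact: ltW|exact: mulr_ge0].
  have h4 : 0 <= u * a by rewrite mulr_ge0 // ltW.
  have h5 : 0 <= u * (q * k) by rewrite !mulr_ge0 // ltW.
  have h6 : 0 <= q * k by rewrite mulr_ge0.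
  lra.
rewrite unlock.
set J := (\int[P]_w _)%E.
have J0 : (0 <= J)%E by apply: integral_ge0 => w _; rewrite lee_fin sqnorm_ge0.
(* The bound for the empty model already shows that the risk is finite. *)
have Jfin : J \is a fin_num.
  rewrite ge0_fin_numE //; apply: le_lt_trans (bound finset.set0 _) (ltry _).
  by rewrite cards0.
rewrite -(fineK Jfin) in J0 *; set j := fine J in J0 *.
(* Solving for the infimum reduces the goal to a lower bound on each single model. *)
suff : ((j / C - sigma ^+ 2)%:E <= ereal_inf S)%E.
  case: (ereal_inf S) inf0 => [i|_ _|//]; last first.
    by rewrite addye // gt0_muley ?lte_fin // leey.
  by rewrite !lee_fin lerBlDr ler_pdivrMr // mulrC.
apply/ereal_infP => x [M Mr <-]; rewrite unlock.
apply: le_trans (expected_loss_ge beta rX Xr sigma0 Heps Mr).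
rewrite lee_fin lerBlDr ler_pdivrMr // mulrC -lee_fin fineK //.
exact: bound.
Qed.
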